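(* Let $G$ be a connected integrally represented edge-signed graph with smallest eigenvalue greater than $-2$. Let $H$ be the representation graph of $G$ for some integral representation. Then one of the following holds: (i) $H$ is a simple tree or $H$ is unicyclic with an odd cycle, and $G$ is switching equivalent to the line graph $\mathfrak{L}(H)$ (with all edges being $(+)$-edges); (ii) $H$ is unicyclic with an even cycle $C$, and $G$ is switching equivalent to $\mathfrak{L}^\dagger(H,uu')$, where $uu'$ is an edge of $\mathfrak{L}(C)$; (iii) $H$ is a tree with a double edge, and $G$ is switching equivalent to the edge-signed graph obtained from the line graph $\mathfrak{L}(H')$ (all of whose edges are $(+)$-edges), where $H'$ is the simple tree obtained from $H$ by deleting one of the two parallel edges and $u\in V(\mathfrak{L}(H'))$ is the remaining one, by attaching a new vertex $u'$ and joining $u'$ by $(+)$-edges to every vertex of one of the two cliques forming the neighbourhood of $u$, and by $(-)$-edges to every vertex of the other clique in the neighbourhood of $u$ (with $u'$ not adjacent to any other vertex, in particular not to $u$). Conversely, if $G$ is an edge-signed graph such that (i), (ii), or (iii) holds for some graph $H$, then $G$ is integrally represented and has smallest eigenvalue greater than $-2$.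
   Context: All graphs are finite. An edge-signed graph $G$ is a triple $(V,E^+,E^-)$ of a vertex set $V$ and two disjoint sets $E^+,E^-$ of $2$-subsets of $V$ (the $(+)$-edges and $(-)$-edges). Its underlying graph is $(V,E^+\cup E^-)$; $G$ is connected if its underlying graph is. Its adjacency matrix has entry $1$, $-1$, $0$ at $(u,v)$ according as $\{u,v\}\in E^+$, $\{u,v\}\in E^-$, or neither; the eigenvalues of $G$ are those of this matrix. Unsigned graphs are regarded as edge-signed graphs with $E^-=\emptyset$. Switching at a vertex $v$ means swapping the sign of each edge incident to $v$. Two edge-signed graphs $G,G'$ are switching equivalent if $G'$ is isomorphic (by a sign-preserving isomorphism) to a graph obtained from $G$ by switching at each vertex of some subset of $V(G)$. An integral representation of $G$ is a map $\phi:V(G)\to\mathbb{Z}^n$, for some $n$, with $(\phi(u),\phi(u))=2$ for all $u$, and for $u\ne v$: $(\phi(u),\phi(v))=\pm1$ if $\{u,v\}\in E^\pm(G)$ respectively, and $(\phi(u),\phi(v))=0$ otherwise. $G$ is integrally represented if it has an integral representation. Given an integral representation, discard the coordinates that vanish on all $\phi(v)$, so that the $n\times m$ matrix ($m=|V(G)|$) whose columns are the $\phi(v)$ has no zero row. Each $\phi(v)$ has exactly two nonzero entries, each $\pm1$. The representation graph $H$ of $G$ associated with $\phi$ has vertex set $\{1,\dots,n\}$ and one edge for each $v\in V(G)$, joining the two elements of $\operatorname{supp}(\phi(v))$; $H$ may have multiple edges. A simple graph is one without multiple edges. Trees here have at least one edge. A unicyclic graph is a connected simple graph with exactly one cycle.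 A tree with a double edge is a multigraph obtained from a simple tree by replacing exactly one edge by two parallel edges. $\mathfrak{L}(H)$ denotes the line graph. In the line graph of a tree, the neighbourhood of a vertex $u$ (an edge of the tree with endpoints $v,w$) is the disjoint union of two (possibly empty) cliques: the other edges at $v$ and the other edges at $w$. Let $H$ be unicyclic whose unique cycle $C$ has at least $4$ vertices. Each edge $e$ of $\mathfrak{L}(H)$ lies in a unique maximal clique of $\mathfrak{L}(H)$, denoted $\mathfrak{C}(e)$. For an edge $uu'$ of $\mathfrak{L}(C)$, $\mathfrak{L}^\dagger(H,uu')$ is the edge-signed graph with vertex set $V(\mathfrak{L}(H))$, $E^-=\{uv\in E(\mathfrak{L}(H)) : v\in\mathfrak{C}(uu')\}$ (the edges joining the fixed vertex $u$ to the other vertices of the clique), and $E^+=E(\mathfrak{L}(H))\setminus E^-$. *)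

(* Defs.v *)
From mathcomp Require Import all_boot all_order all_algebra all_field.
From mathcomp Require Import zify.
Set Implicit Arguments.
Unset Strict Implicit.
Unset Printing Implicit Defensive.
Import Order.TTheory GRing.Theory Num.Theory.

Local Open Scope ring_scope.

Record sgraph (V : finType) := SGraph {
  spos : rel V;
  sneg : rel V;
  spos_sym : symmetric spos;
  sneg_sym : symmetric sneg;
  spos_irr : irreflexive spos;
  sneg_irr : irreflexive sneg;
  sdisj : forall x y, ~~ (spos x y && sneg x y)
}.

Definition sadj (V : finType) (G : sgraph V) : rel V :=
  fun x y => spos G x y || sneg G x y.

Definition sconnected (V : finType) (G : sgraph V) : Prop :=
  (0 < #|V|)%N /\ forall x y, connect (sadj G) x y.

Definition ssign (V : finType) (G : sgraph V) (x y : V) : int :=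
  if spos G x y then 1 else if sneg G x y then -1 else 0.

Definition sadj_mx (V : finType) (G : sgraph V) : 'M[algC]_#|V| :=
  \matrix_(i, j) (ssign G (enum_val i) (enum_val j))%:~R.

(* The eigenvalues are algebraic since the matrix is integral, and real since
   it is symmetric, so that the partial order of [algC] is total on them. *)
Definition smallest_eigenvalue (V : finType) (G : sgraph V) (a : algC) : Prop :=
  eigenvalue (sadj_mx G) a /\ forall b, eigenvalue (sadj_mx G) b -> a <= b.

Definition smallest_eigenvalue_gt_m2 (V : finType) (G : sgraph V) : Prop :=
  exists2 a, smallest_eigenvalue G a & -2 < a.

Section Switching.
Variables (V : finType) (G : sgraph V) (v : V).

Definition switch_pos : rel V := fun x y =>
  if (x == v) || (y == v) then sneg G x y else spos G x y.
Definition switch_neg : rel V := fun x y =>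
  if (x == v) || (y == v) then spos G x y else sneg G x y.

Fact switch_pos_sym : symmetric switch_pos.
Proof.
by move=> x y; rewrite /switch_pos orbC (sneg_sym G x) (spos_sym G x).
Qed.
Fact switch_neg_sym : symmetric switch_neg.
Proof.
by move=> x y; rewrite /switch_neg orbC (sneg_sym G x) (spos_sym G x).
Qed.
Fact switch_pos_irr : irreflexive switch_pos.
Proof. by move=> x; rewrite /switch_pos spos_irr sneg_irr if_same. Qed.
Fact switch_neg_irr : irreflexive switch_neg.
Proof. by move=> x; rewrite /switch_neg spos_irr sneg_irr if_same. Qed.
Fact switch_disj x y : ~~ (switch_pos x y && switch_neg x y).
Proof.
by rewrite /switch_pos /switch_neg; case: ifP => _; rewrite ?sdisj // andbC sdisj.
Qed.

Definition switch_at : sgraph V :=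
  SGraph switch_pos_sym switch_neg_sym switch_pos_irr switch_neg_irr switch_disj.
End Switching.

Definition switch_set (V : finType) (G : sgraph V) (S : {set V}) : sgraph V :=
  foldr (fun v G' => switch_at G' v) G (enum S).

Definition siso (V W : finType) (G : sgraph V) (G' : sgraph W) : Prop :=
  exists2 f : V -> W, bijective f &
    forall x y, spos G' (f x) (f y) = spos G x y
             /\ sneg G' (f x) (f y) = sneg G x y.

Definition switching_equivalent (V W : finType)
    (G : sgraph V) (G' : sgraph W) : Prop :=
  exists S : {set V}, siso (switch_set G S) G'.

Record mgraph := MGraph {
  mvert : finType;
  medge : finType;
  mends : medge -> {set mvert};
  mends_card : forall e, #|mends e| = 2%N
}.

Definition miso (H K : mgraph) : Prop :=
  exists (f : mvert H -> mvert K) (g : medge H -> medge K),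
    [/\ bijective f, bijective g & forall e, mends (g e) = f @: mends e].

Definition madj (H : mgraph) : rel (mvert H) :=
  fun x y => [exists e, mends e == [set x; y]].

Definition mconnected (H : mgraph) : Prop :=
  (0 < #|mvert H|)%N /\ forall x y, connect (@madj H) x y.

Definition msimple (H : mgraph) : Prop := injective (@mends H).

(* A cycle is identified with its edge set, so that cycles differing only by
   starting point or orientation coincide; k = 1 is impossible as there are no
   loops, and k = 2 amounts to a pair of parallel edges. *)
Definition is_cycle (H : mgraph) (C : {set medge H}) : Prop :=
  exists (k : nat) (x : 'I_k -> mvert H) (e : 'I_k -> medge H),
    [/\ (0 < k)%N, injective x, injective e,
        forall i, mends (e i) = [set x i; x (ordS i)]
      & C = [set e i | i : 'I_k]].

Definition is_tree (H : mgraph) : Prop :=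
  [/\ mconnected H, msimple H, (0 < #|medge H|)%N
    & forall C : {set medge H}, ~ is_cycle C].

Definition unicyclic_with (H : mgraph) (C : {set medge H}) : Prop :=
  [/\ mconnected H, msimple H, is_cycle C
    & forall D : {set medge H}, is_cycle D -> D = C].

(* [None] is the added edge, parallel to [e]. *)
Definition dup_edge (T : mgraph) (e : medge T) : mgraph :=
  @MGraph (mvert T) (option (medge T))
    (fun o => mends (odflt e o)) (fun o => mends_card (odflt e o)).

Definition is_tree_with_double_edge (H : mgraph) : Prop :=
  exists (T : mgraph) (e : medge T), is_tree T /\ miso H (dup_edge e).

Definition del_edge (H : mgraph) (d : medge H) : mgraph :=
  @MGraph (mvert H) {e : medge H | e != d}
    (fun e => mends (val e)) (fun e => mends_card (val e)).

Definition ladj (H : mgraph) : rel (medge H) :=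
  fun e f => (e != f) && (mends e :&: mends f != set0).

Fact ladj_sym (H : mgraph) : symmetric (@ladj H).
Proof. by move=> e f; rewrite /ladj eq_sym setIC. Qed.
Fact ladj_irr (H : mgraph) : irreflexive (@ladj H).
Proof. by move=> e; rewrite /ladj eqxx. Qed.

Section LineGraph.
Variable H : mgraph.

Fact line_neg_sym : symmetric (fun _ _ : medge H => false). Proof. by []. Qed.
Fact line_neg_irr : irreflexive (fun _ _ : medge H => false). Proof. by []. Qed.
Fact line_disj (x y : medge H) : ~~ (ladj x y && false).
Proof. by rewrite andbF. Qed.

Definition line_sgraph : sgraph (medge H) :=
  SGraph (@ladj_sym H) line_neg_sym (@ladj_irr H) line_neg_irr line_disj.
End LineGraph.

Section LDagger.
Variable H : mgraph.

Definition lclique (K : {set medge H}) : bool :=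
  [forall x in K, forall y in K, (x != y) ==> ladj x y].

(* The maximal clique of the line graph containing the edge [u u'] is unique
   when [H] is unicyclic with a cycle of length at least 4, the only case in
   which this is used. *)
Definition max_clique_of (u u' : medge H) : {set medge H} :=
  odflt set0 [pick K : {set medge H} | maxset lclique K & (u \in K) && (u' \in K)].

Variables u u' : medge H.

Definition ldagger_neg : rel (medge H) := fun x y =>
  ladj x y && ((x == u) && (y \in max_clique_of u u')
            || (y == u) && (x \in max_clique_of u u')).
Definition ldagger_pos : rel (medge H) := fun x y =>
  ladj x y && ~~ ldagger_neg x y.

Fact ldagger_neg_sym : symmetric ldagger_neg.
Proof. by move=> x y; rewrite /ldagger_neg ladj_sym orbC. Qed.
Fact ldagger_pos_sym : symmetric ldagger_pos.
Proof. by move=> x y; rewrite /ldagger_pos ladj_sym ldagger_neg_sym. Qed.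
Fact ldagger_neg_irr : irreflexive ldagger_neg.
Proof. by move=> x; rewrite /ldagger_neg ladj_irr. Qed.
Fact ldagger_pos_irr : irreflexive ldagger_pos.
Proof. by move=> x; rewrite /ldagger_pos ladj_irr. Qed.
Fact ldagger_disj x y : ~~ (ldagger_pos x y && ldagger_neg x y).
Proof. by rewrite /ldagger_pos; case: (ldagger_neg x y); rewrite !(andbF, andbT). Qed.

Definition ldagger : sgraph (medge H) :=
  SGraph ldagger_pos_sym ldagger_neg_sym ldagger_pos_irr ldagger_neg_irr
    ldagger_disj.
End LDagger.

Definition other_edges (H : mgraph) (u : medge H) (v : mvert H) : {set medge H} :=
  [set f | (f != u) & (v \in mends f)].

(* [None] is the new vertex, joined by (+)-edges to [A] and by (-)-edges to
   [B]; removing [A] from [B] only serves to make the construction total, as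
   the two sets are disjoint in the intended use. *)
Section Attach.
Variables (H : mgraph) (A B : {set medge H}).

Definition attach_pos : rel (option (medge H)) := fun x y =>
  match x, y with
  | Some e, Some f => ladj e f
  | None, Some f => f \in A
  | Some e, None => e \in A
  | None, None => false
  end.
Definition attach_neg : rel (option (medge H)) := fun x y =>
  match x, y with
  | None, Some f => f \in B :\: A
  | Some e, None => e \in B :\: A
  | _, _ => false
  end.

Fact attach_pos_sym : symmetric attach_pos.
Proof. by case=> [e|] [f|] //=; rewrite ladj_sym. Qed.
Fact attach_neg_sym : symmetric attach_neg.
Proof. by case=> [e|] [f|]. Qed.
Fact attach_pos_irr : irreflexive attach_pos.
Proof. by case=> [e|] //=; rewrite ladj_irr. Qed.
Fact attach_neg_irr : irreflexive attach_neg.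
Proof. by case. Qed.
Fact attach_disj x y : ~~ (attach_pos x y && attach_neg x y).
Proof. by case: x y => [e|] [f|] //=; rewrite ?andbF // inE; case: (_ \in A). Qed.

Definition attach : sgraph (option (medge H)) :=
  SGraph attach_pos_sym attach_neg_sym attach_pos_irr attach_neg_irr attach_disj.
End Attach.

Definition dot (n : nat) (a b : 'cV[int]_n) : int := \sum_i a i 0 * b i 0.

Definition integral_rep (V : finType) (G : sgraph V) (n : nat)
    (phi : V -> 'cV[int]_n) : Prop :=
  (forall u, dot (phi u) (phi u) = 2) /\
  (forall u v, u != v -> dot (phi u) (phi v) = ssign G u v).

Definition integrally_represented (V : finType) (G : sgraph V) : Prop :=
  exists (n : nat) (phi : V -> 'cV[int]_n), integral_rep G phi.

Section RepGraph.
Variables (V : finType) (G : sgraph V) (n : nat) (phi : V -> 'cV[int]_n).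

Definition rep_vert : finType := {i : 'I_n | [exists v, phi v i 0 != 0]}.
Definition rep_ends (v : V) : {set rep_vert} :=
  [set i | phi v (val i) 0 != 0].

Hypothesis phiP : integral_rep G phi.

Lemma card_rep_ends v : #|rep_ends v| = 2%N.
Proof.
pose S := [set i | phi v i 0 != 0].
have -> : #|rep_ends v| = #|S|.
  rewrite -(card_imset _ val_inj); congr #|pred_of_set _|; apply/setP=> i.
  apply/imsetP/idP => [[j]|]; first by rewrite !inE => jP ->.
  rewrite inE => iP.
  have iQ : [exists w, phi w i 0 != 0] by apply/existsP; exists v.
  by exists (Sub i iQ : rep_vert); rewrite // inE.
have sum2 : \sum_(i in S) phi v i 0 * phi v i 0 = 2.
  rewrite -(phiP.1 v) /dot [RHS](bigID [in S]) /= [X in _ + X]big1 ?addr0 //.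
  by move=> i; rewrite inE negbK => /eqP->; rewrite mul0r.
have leS : (#|S| <= 2)%N.
  have : \sum_(i in S) (1 : int) <= \sum_(i in S) phi v i 0 * phi v i 0.
    by apply: ler_sum => i; rewrite inE; nia.
  by rewrite sum2 sumr_const; lia.
case cS : #|S| leS => [|[|[|k]]] // _.
  by move: sum2; rewrite (cards0_eq cS) big_set0.
have /cards1P [i Si] : #|S| == 1%N by rewrite cS.
move: sum2; rewrite Si big_set1; move: (phi v i 0) => a.
by have [/=|] : (`|a| <= 1)%N \/ (2 <= `|a|)%N; [lia | nia | nia].
Qed.

Definition rep_graph : mgraph := MGraph card_rep_ends.
End RepGraph.

Definition case_i (V : finType) (G : sgraph V) (H : mgraph) : Prop :=
  (is_tree H \/ exists C : {set medge H}, unicyclic_with C /\ odd #|C|) /\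
  switching_equivalent G (line_sgraph H).

Definition case_ii (V : finType) (G : sgraph V) (H : mgraph) : Prop :=
  exists C : {set medge H},
    [/\ unicyclic_with C, ~~ odd #|C| &
        exists u u' : medge H,
          [/\ u \in C, u' \in C, ladj u u'
            & switching_equivalent G (ldagger u u')]].

Definition case_iii (V : finType) (G : sgraph V) (H : mgraph) : Prop :=
  is_tree_with_double_edge H /\
  exists (d : medge H) (u : medge (del_edge d)) (v w : mvert (del_edge d)),
    [/\ mends (val u) = mends d, mends u = [set v; w]
      & switching_equivalent G (attach (other_edges u v) (other_edges u w))].

(* Main.v *)
Require Import Defs.
From mathcomp Require Import all_boot all_order all_algebra all_field.
From mathcomp Require Import zify ring.
Set Implicit Arguments.
Unset Strict Implicit.
Unset Printing Implicit Defensive.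
Import Order.TTheory GRing.Theory Num.Theory.
Local Open Scope ring_scope.

(** A signing of a multigraph [H] puts a sign on each incidence of an edge with
a vertex.  The signed incidence vectors of the edges have norm 2, and their
Gram matrix off the diagonal is the adjacency matrix of an edge-signed graph on
the edges of [H]; every integral representation is of this kind for its
representation graph.  Changing the signs of all incidences at a vertex leaves
the Gram matrix alone, and changing both signs of an edge is a switching.

If [B] is the matrix whose rows are the incidence vectors then
[A + 2 = B B^T], so the smallest eigenvalue exceeds [-2] exactly when the
incidence vectors are linearly independent ([smallest_gt_m2P]).  The theorem is
therefore about signings of connected multigraphs: they are independent exactly
on trees and on multigraphs whose only cycle is unbalanced, a pair of parallel
edges counting as a cycle of length 2, and each such signing reduces to a
standard one by sign changes at vertices and edges.

Only one fact about signed cycles is computed: some combination of the vectors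
of the edges of a cycle [C] is [1 - balance C] times a unit vector
([cycle_combination]).  Hence a balanced cycle is dependent
([indep_unbalanced]), while on an unbalanced one every potential, that is, every
vector on the vertices orthogonal to the incidence vectors, has a zero
([unbalanced_potential]).  Zeros of a potential spread along edges, so by
connectedness it then vanishes.  Everything else comes from counting: fewer
vectors than coordinates always leave a nonzero potential
([kernel_nontrivial]).
- Two distinct cycles cannot occur in an independent signing: delete an edge
  that lies on only one of them.  The graph stays connected and there are fewer
  edges than vertices, yet the other cycle kills all potentials
  ([cycle_unique]).
- A potential of a signing with one sign per edge reversed is constant up to
  sign along a connected graph, and its signs are the sign changes at vertices
  that make both signs of every edge agree ([gauge]).  On a tree there is room
  for such a potential; on a unicyclic graph there is after deleting one cycle
  edge, and the balance of the cycle then forces the signs of that edge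
  ([signing_classification]).
- As many edges as vertices force a cycle ([many_edges_have_cycle]), so a
  connected graph all of whose cycles share an edge has at most as many edges
  as vertices.  If it also has an unbalanced cycle, a dependence would leave
  room for a nonzero potential ([unicyclic_indep]).

The three standard signings are then identified with the line graph, with the
line graph in which one vertex has its sign changed towards a clique, and with
the line graph with a vertex attached ([line_realizes], [ldagger_realizes],
[attach_realizes]). *)

(** * Homogeneous linear systems *)

(** Underdetermined homogeneous systems, in the form that serves for both rows
and columns of an incidence matrix: only the equations in [A] and the unknowns
in [B] are kept. *)
Lemma kernel_nontrivial (F : fieldType) (I J : finType) (a : I -> J -> F)
    (A : {set I}) (B : {set J}) :
  (#|A| < #|B|)%N ->
  exists y : J -> F, [/\ exists j, y j != 0, forall j, j \notin B -> y j = 0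
    & forall i, i \in A -> \sum_j y j * a i j = 0].
Proof.
move=> ltAB.
pose M : 'M[F]_(#|B|, #|A|) := \matrix_(j, i) a (enum_val i) (enum_val j).
have : kermx M != 0.
  by rewrite -mxrank_eq0 mxrank_ker subn_eq0 -ltnNge (leq_ltn_trans (rank_leq_col M)).
case/rowV0Pn=> v /sub_kermxP vM0 v0.
pose y j := \sum_t (enum_val t == j)%:R * v 0 t.
have yE t : y (enum_val t) = v 0 t.
  rewrite /y (bigD1 t) //= eqxx mul1r big1 ?addr0 // => t' t't.
  by rewrite (inj_eq enum_val_inj) (negbTE t't) mul0r.
exists y; split.
- have [t vt|v00] := pickP (fun t => v 0 t != 0).
    by exists (enum_val t); rewrite yE.
  case/eqP: v0; apply/rowP=> t; rewrite mxE.
  by have /negbFE/eqP := v00 t.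
- move=> j jB; rewrite /y big1 // => t _.
  by case: eqP jB => [<-|_ _]; rewrite ?enum_valP // mul0r.
move=> i iA.
have := congr1 (fun N : 'rV__ => N 0 (enum_rank_in iA i)) vM0.
rewrite !mxE => vi0; rewrite -[RHS]vi0.
under eq_bigr do rewrite mulr_suml.
rewrite exchange_big; apply: eq_bigr => t _ /=.
rewrite (bigD1 (enum_val t)) //= eqxx mul1r big1 ?addr0 => [|j /negbTE jt].
  by rewrite mxE enum_rankK_in.
by rewrite eq_sym jt !mul0r.
Qed.

(** * Walks and cycles in multigraphs *)

Lemma ordinal_injective_of_lt (T : Type) (g : nat -> T) k :
  (forall p q, (p < q)%N -> (q < k)%N -> g p <> g q) ->
  injective (fun t : 'I_k => g t).
Proof.
move=> gI p q gpq; apply/val_inj.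
have [lt|lt|//] := ltngtP p q; first by case: (gI _ _ lt (ltn_ord q)).
by case: (gI _ _ lt (ltn_ord p)).
Qed.

Section Multigraph.
Variable H : mgraph.
Implicit Types (e f : medge H) (x y a b : mvert H) (C D S : {set medge H}).

Lemma ends_pair e : exists a b, mends e = [set a; b].
Proof.
by have /eqP/cards2P[a [b [_ ->]]] := mends_card e; exists a, b.
Qed.

Lemma ends_neq e a b : mends e = [set a; b] -> a != b.
Proof. by move=> E; have := mends_card e; rewrite E cards2; case: (a != b). Qed.

(** Indexing a cycle periodically by [nat] allows it to be traversed from any of
its edges without modular arithmetic on ordinals. *)
Lemma cycle_walk C : is_cycle C ->
  exists k (X : nat -> mvert H) (E : nat -> medge H),
    [/\ (1 < k)%N, forall i, mends (E i) = [set X i; X i.+1],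
        (forall i, X (i + k)%N = X i) /\ (forall i, E (i + k)%N = E i),
        forall i j, (i < k)%N -> (j < k)%N -> E i = E j -> i = j
      & C = [set E (val i) | i : 'I_k]].
Proof.
case=> k [x [e [k0 xI eI eE ->]]].
pose m i : 'I_k := Ordinal (ltn_pmod i k0).
have mS i : ordS (m i) = m i.+1.
  by apply/val_inj; rewrite /= -addn1 modnDml addn1.
have mk i : m (i + k)%N = m i by apply/val_inj; rewrite /= modnDr.
have mE (i : 'I_k) : m i = i by apply/val_inj; rewrite /= modn_small.
exists k, (x \o m), (e \o m); split => //=.
- case: (ltngtP k 1) => // [|k1]; first by case: k k0 {x e xI eI eE m mS mk mE}.
  have /ends_neq/eqP[] := eE (m 0%N); congr x; apply/val_inj => /=.
  by rewrite k1 !modn1.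
- by move=> i; rewrite eE mS.
- by split=> i; rewrite mk.
- by move=> i j ik jk /eI /(congr1 val) /=; rewrite !modn_small.
by apply: eq_imset => i /=; rewrite mE.
Qed.

Lemma parallel_cycle d u : d != u -> mends d = mends u -> @is_cycle H [set d; u].
Proof.
move=> du dE; have [a [b uE]] := ends_pair u; have ab := ends_neq uE.
exists 2%N, (fun i : 'I_2 => if i == ord0 then a else b),
  (fun i : 'I_2 => if i == ord0 then d else u).
split=> //.
- by case=> [[|[|//]] ?] [[|[|//]] ?] //= E; apply/val_inj => //=;
    move/eqP: E; rewrite // ?(negbTE ab) // eq_sym (negbTE ab).
- by case=> [[|[|//]] ?] [[|[|//]] ?] //= E; apply/val_inj => //=;
    move/eqP: E; rewrite // ?(negbTE du) // eq_sym (negbTE du).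
- by case=> [[|[|//]] ?]; rewrite /= ?dE uE // setUC.
apply/setP=> e; rewrite !inE; apply/idP/imsetP => [/orP[]/eqP->|[i _ ->]].
- by exists ord0.
- by exists ord_max.
by case: (i == ord0); rewrite eqxx ?orbT.
Qed.

Lemma triangle_cycle a b c (e f g : medge H) :
  mends e = [set a; b] -> mends f = [set b; c] -> mends g = [set c; a] ->
  @is_cycle H [set e; f; g].
Proof.
move=> eE fE gE.
have ab := ends_neq eE; have bc := ends_neq fE; have ca := ends_neq gE.
have mem (h1 h2 : medge H) z : z \in mends h1 -> z \notin mends h2 -> h1 != h2.
  by move=> z1 z2; apply: contraNneq z2 => <-.
have ef : e != f.
  by apply: (mem _ _ a); rewrite ?eE ?fE !inE ?eqxx // negb_or ab eq_sym.
have fg : f != g.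
  by apply: (mem _ _ b); rewrite ?fE ?gE !inE ?eqxx // negb_or bc eq_sym.
have ge : g != e.
  by apply: (mem _ _ c); rewrite ?gE ?eE !inE ?eqxx // negb_or ca eq_sym.
have inj3 (T : eqType) (x y z : T) : x != y -> y != z -> z != x ->
    injective (fun i : 'I_3 => nth x [:: x; y; z] i).
  move=> xy yz zx i j /eqP; rewrite nth_uniq //= ?ltn_ord //.
    by move/eqP/val_inj.
  by rewrite !inE negb_or xy yz eq_sym zx.
exists 3%N, (fun i : 'I_3 => nth a [:: a; b; c] i),
  (fun i : 'I_3 => nth e [:: e; f; g] i); split; rewrite //; try exact: inj3.
- by case=> [[|[|[|//]]] ?].
apply/setP=> h; rewrite !inE; apply/idP/imsetP => [/orP[/orP[]|]/eqP->|[i _ ->]].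
- by exists (inord 0); rewrite // inordK.
- by exists (inord 1); rewrite // inordK.
- by exists (inord 2); rewrite // inordK.
by case: i => [[|[|[|//]]] ?] /=; rewrite eqxx ?orbT.
Qed.

(** The part of the walk before the first return to an earlier vertex is a
cycle.  Its edges are distinct: two equal ones would repeat a vertex too early,
unless they are the two edges of a segment of length 2, which is excluded as
the walk never goes straight back. *)
Lemma walk_has_cycle (X : nat -> mvert H) (E : nat -> medge H) :
  (forall i, mends (E i) = [set X i; X i.+1]) -> (forall i, E i.+1 != E i) ->
  exists2 C, is_cycle C & forall e, e \in C -> exists i, e = E i.
Proof.
move=> EX nbt.
have exj : exists j, [exists i : 'I_j, X i == X j].
  have: ~~ injectiveb (fun i : 'I_#|mvert H|.+1 => X i).
    by apply/negP=> /injectiveP/leq_card; rewrite card_ord ltnn.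
  case/injectivePn=> i [j ij Xij].
  have [lt|lt|/val_inj E0] := ltngtP i j; last by rewrite E0 eqxx in ij.
    by exists j; apply/existsP; exists (Ordinal lt); apply/eqP.
  by exists i; apply/existsP; exists (Ordinal lt); apply/eqP.
case: (ex_minnP exj) => j /existsP[[i ij] /= /eqP Xij] jmin.
have Xinj p q : (p < q)%N -> (q < j)%N -> X p <> X q.
  move=> pq qj Xpq; suff: (j <= q)%N by rewrite leqNgt qj.
  by apply: jmin; apply/existsP; exists (Ordinal pq); rewrite Xpq.
have Einj p q : (i <= p)%N -> (p < q)%N -> (q < j)%N -> E p <> E q.
  move=> ip pq qj Epq; have := EX q; rewrite -Epq EX => /setP S.
  have := S (X p); rewrite !inE eqxx => /esym/orP[/eqP|/eqP Xp].
    exact: Xinj.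
  have qj1 : q.+1 = j.
    by apply/eqP; rewrite eqn_leq qj leqNgt; apply/negP=> lt;
    by apply: (Xinj p q.+1) lt Xp; rewrite ltnS ltnW.
  have := S (X q); rewrite !inE eqxx /= => /orP[/eqP/esym|/eqP Xq].
    exact: Xinj.
  have [|qp] := ltnP p.+1 q; first by move=> lt; case: (Xinj _ _ lt qj).
  have qp1 : q = p.+1 by lia.
  by have /eqP[] := nbt p; rewrite -qp1 Epq.
pose k := (j - i)%N.
exists [set E (i + t)%N | t : 'I_k] => [|e /imsetP[t _ ->]]; last by eexists.
exists k, (fun t : 'I_k => X (i + t)%N), (fun t : 'I_k => E (i + t)%N).
split=> //.
- by rewrite subn_gt0.
- apply: (@ordinal_injective_of_lt _ (fun t => X (i + t)%N)) => p q pq qk.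
  by rewrite /k in qk; apply: Xinj;
    rewrite ?leq_addr ?ltn_add2l //; lia.
- apply: (@ordinal_injective_of_lt _ (fun t => E (i + t)%N)) => p q pq qk.
  by rewrite /k in qk; apply: Einj;
    rewrite ?leq_addr ?ltn_add2l //; lia.
move=> t; rewrite EX -addnS /=; have := ltn_ord t.
rewrite leq_eqVlt => /orP[/eqP E1|lt]; last by rewrite modn_small.
by rewrite E1 modnn addn0 /k subnKC ?Xij // ltnW.
Qed.

(** Every vertex reached can be left through another edge of [S], so there is
an infinite walk without backtracking. *)
Lemma min_degree_two_has_cycle S : S != set0 ->
  (forall e x, e \in S -> x \in mends e ->
     exists2 f, f \in S & (f != e) && (x \in mends f)) ->
  exists2 C, is_cycle C & C \subset S.
Proof.
move=> /set0Pn[e0 e0S] deg.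
(* A state of the walk is the edge just used with the vertex it led to. *)
pose st := (medge H * mvert H)%type.
pose ok (p : st) := (p.1 \in S) && (p.2 \in mends p.1).
pose step (p q : st) := [&& ok q, q.1 != p.1 & mends q.1 == [set p.2; q.2]].
pose nxt p := odflt p [pick q | step p q].
have nxtP p : ok p -> step p (nxt p).
  case: p => e x /andP[/= eS xe]; rewrite /nxt; case: pickP => //= none.
  have [f fS /andP[fe xf]] := deg e x eS xe.
  have [y yx fE] : exists2 y, y \in mends f & mends f = [set x; y].
    have [a [b fE]] := ends_pair f; move: xf; rewrite fE !inE.
    case/orP=> /eqP->; first by exists b; rewrite // !inE eqxx orbT.
    by exists a; rewrite ?inE ?eqxx // setUC.
  by have := none (f, y); rewrite /step /ok /= fS yx fe fE eqxx.
have [a [b e0E]] := ends_pair e0.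
pose p i := iter i nxt (e0, a).
have okp i : ok (p i).
  elim: i => [|i /nxtP/and3P[]//].
  by rewrite /ok /= e0S e0E !inE eqxx.
have stepp i := nxtP _ (okp i).
case: (@walk_has_cycle (fun i => (p i).2) (fun i => (p i.+1).1)).
- by move=> i; have /and3P[_ _ /eqP] := stepp i.
- by move=> i; have /and3P[] := stepp i.+1.
move=> C Cc CE; exists C => //; apply/subsetP=> e /CE[i ->].
by have /andP[] := okp i.+1.
Qed.

End Multigraph.

(** * Connectedness *)

Section Connectivity.
Variable H : mgraph.
Implicit Types (e : medge H) (x y a b : mvert H) (A C : {set medge H}).

Definition edge_closed A (P : pred (mvert H)) :=
  forall e a b, e \in A -> mends e = [set a; b] -> P a -> P b.

(** Connectedness of the spanning subgraph with edge set [A], stated without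
paths so that it applies directly to properties of potentials. *)
Definition connecting A :=
  forall P, edge_closed A P -> forall x y, P x -> P y.

Lemma mconnectedP :
  mconnected H <-> (0 < #|mvert H|)%N /\ connecting [set: medge H].
Proof.
split=> [][n0 conn]; split=> //; [move=> P Pcl x y | move=> x y].
  have cl : closed (@madj H) P.
    move=> a b /existsP[e /eqP eE]; apply/idP/idP; apply: (Pcl e) => //.
    by rewrite setUC.
  by have := closed_connect cl (conn x y); rewrite -!topredE /= => ->.
apply: (conn (connect (@madj H) x) _ x) (connect0 _ _) => e a b _ eE xa.
by apply: connect_trans xa (connect1 _); apply/existsP; exists e; rewrite eE.
Qed.

(** The rest of the cycle is a path between the ends of [e0]. *)
Lemma closed_around_cycle C e0 P a b : is_cycle C -> e0 \in C ->
  edge_closed (C :\ e0) P -> mends e0 = [set a; b] -> P a -> P b.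
Proof.
case/cycle_walk=> k [X [E [k1 EX [Xk Ek] EI ->]]] /imsetP[i0 _ ->] Pcl.
have walk j : (j < k)%N -> P (X (i0 + 1 + j)%N) = P (X i0.+1).
  elim: j => [|j IH] jk; first by rewrite addn0 addn1.
  rewrite -(IH (ltnW jk)) addnS.
  have : E (i0 + 1 + j)%N \in [set E (val i) | i : 'I_k] :\ E i0.
    have k0 : (0 < k)%N by exact: ltnW.
    have perE m : E m = E (m %% k)%N.
      rewrite {1}(divn_eq m k); elim: (m %/ k)%N => // q IHq.
      by rewrite mulSnr addnAC Ek.
    rewrite !inE; apply/andP; split; last first.
      apply/imsetP; exists (Ordinal (ltn_pmod (i0 + 1 + j) k0)) => //=.
    rewrite perE; apply/eqP => /EI; rewrite ltn_pmod // ltn_ord => /(_ isT isT).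
    move/eqP; rewrite -[X in _ == X](modn_small (ltn_ord i0)) -addnA.
    by rewrite -[X in _ == X %[mod _]]addn0 eqn_modDl mod0n modn_small //; lia.
  move=> Ein; apply/idP/idP; apply: (Pcl _ _ _ Ein); rewrite EX //.
  by rewrite setUC.
have closed_end : P (X i0) = P (X i0.+1).
  have k0 : (0 < k)%N by exact: ltnW.
  rewrite -(walk k.-1); last by rewrite prednK.
  by rewrite -addnA add1n prednK ?Xk.
rewrite EX => /setP S; have := S a; have := S b.
rewrite !inE !eqxx orbT /=.
by do 2![case/orP=> /eqP->]; rewrite ?closed_end.
Qed.

Lemma connecting_cycle_edge C e0 : is_cycle C -> e0 \in C ->
  connecting [set: medge H] -> connecting (~: [set e0]).
Proof.
move=> Cc e0C conn P Pcl; apply: conn => e a b _ eE Pa.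
have [ee0|ne] := eqVneq e e0; last by apply: Pcl eE Pa; rewrite !inE.
apply: closed_around_cycle Cc e0C _ _ Pa; last by rewrite -ee0.
by move=> f x y; rewrite !inE => /andP[fe _]; apply: Pcl; rewrite !inE.
Qed.

End Connectivity.

(** * Signings, balance and potentials *)

Section Signings.
Variable H : mgraph.
Implicit Types (e f : medge H) (x y a b : mvert H) (A C D : {set medge H}).
Implicit Types (s : medge H -> mvert H -> bool).

(** The vector of [e] in a representation, as a function of the coordinate. *)
Definition inc (R : pzRingType) s e x : R :=
  if x \in mends e then (-1) ^+ s e x else 0.

Lemma sum_inc (R : pzRingType) s e a b (y : mvert H -> R) :
  mends e = [set a; b] ->
  \sum_x y x * inc R s e x = y a * (-1) ^+ s e a + y b * (-1) ^+ s e b.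
Proof.
move=> eE; have ab := ends_neq eE.
rewrite (bigD1 a) //= (bigD1 b) 1?eq_sym //= /inc eE !inE !eqxx orbT /=.
rewrite big1 ?addr0 // => x /andP[/negbTE xa /negbTE xb].
by rewrite !inE xa xb mulr0.
Qed.

Definition indep (F : fieldType) s :=
  forall c : medge H -> F,
    (forall x, \sum_e c e * inc F s e x = 0) -> forall e, c e = 0.

(** The factor of [e] is the ratio of the values of a potential at the two ends
of [e], so [balance] is the factor acquired by going once around [C]. *)
Definition balance (R : pzRingType) s C : R :=
  \prod_(e in C) - \prod_(x in mends e) (-1) ^+ s e x.

Lemma balance_sign (R : comPzRingType) s C :
  balance R s C = 1 \/ balance R s C = -1.
Proof.
rewrite /balance; apply: (big_ind (fun z : R => z = 1 \/ z = -1)).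
- by left.
- by move=> y z [->|->] [->|->]; rewrite ?mulrNN ?mulr1 ?mul1r; auto.
move=> e _; have [a [b eE]] := ends_pair e.
rewrite eE big_setU1 ?big_set1 ?inE ?(ends_neq eE) //=.
by case: (s e a); case: (s e b); rewrite ?mulrNN ?mulr1 ?mul1r ?opprK; auto.
Qed.

(** With [t i] the product of the factors of the first [i] edges, the edge
[E i], suitably scaled, contributes [t i] at [X i] and [- t (i + 1)] at the next
vertex.  The sum telescopes, and around the cycle [t] goes from 1 to the
balance. *)
Lemma cycle_combination (F : numFieldType) s C : is_cycle C ->
  exists (c : medge H -> F) x0,
    [/\ exists e, c e != 0, forall e, e \notin C -> c e = 0
      & forall x, \sum_e c e * inc F s e x = (x == x0)%:R * (1 - balance F s C)].
Proof.
case/cycle_walk=> k [X [E [k1 EX [Xk Ek] EI CE]]].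
pose sg i x : F := (-1) ^+ s (E i) x.
pose w i := - (sg i (X i) * sg i (X i.+1)).
pose t i := \prod_(j < i) w j.
pose z i := t i * sg i (X i).
have sgN i x : sg i x * sg i x = 1 by rewrite /sg -expr2 sqrr_sign.
have zN i : z i * sg i (X i.+1) = - t i.+1.
  by rewrite /t big_ord_recr /= -/(t i) /w /z; ring.
have zP i : z i * sg i (X i) = t i by rewrite /z -mulrA sgN mulr1.
exists (fun e => \sum_(i < k) (E i == e)%:R * z i), (X 0%N).
have tN0 i : t i != 0.
  by apply/prodf_neq0 => j _; rewrite oppr_eq0 mulf_eq0 !signr_eq0.
split.
- have k0 : (0 < k)%N by exact: ltnW.
  exists (E 0%N); rewrite (bigD1 (Ordinal k0)) //= eqxx mul1r big1 ?addr0.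
    by rewrite mulf_neq0 ?signr_eq0.
  move=> i i0; case: eqP => [/EI E0|]; rewrite ?mul0r //.
  by case/eqP: i0; apply/val_inj; rewrite /= E0.
- move=> e; rewrite CE => eC; rewrite big1 // => i _.
  case: eqP => [Ee|]; rewrite ?mul0r //.
  by case/imsetP: eC; exists i.
move=> x; under eq_bigr do rewrite mulr_suml.
rewrite exchange_big /=.
have -> : balance F s C = t k.
  rewrite /balance CE big_imset /=; last first.
    by move=> i j _ _ /EI E0; apply/val_inj/E0.
  apply: eq_bigr => i _; rewrite EX big_setU1 ?big_set1 //=.
  by rewrite inE (ends_neq (EX i)).
transitivity (\sum_(0 <= i < k) ((x == X i)%:R * t i - (x == X i.+1)%:R * t i.+1)).
  rewrite big_mkord; apply: eq_bigr => i _.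
  rewrite (bigD1 (E i)) //= eqxx mul1r big1 ?addr0; last first.
    by move=> e /negbTE ne; rewrite eq_sym ne !mul0r.
  have /negbTE ne := ends_neq (EX i).
  rewrite /inc EX !inE; case: (eqVneq x (X i)) => [->|nx] /=.
    by rewrite -/(sg i (X i)) zP ne mul0r mul1r subr0.
  rewrite mul0r sub0r; case: eqP => [->|_]; last by rewrite mulr0 mul0r oppr0.
  by rewrite -/(sg i _) zN mul1r.
have -> (g : nat -> F) : \sum_(0 <= i < k) (g i - g i.+1) = g 0%N - g k.
  rewrite -[RHS]opprB -telescope_sumr // -sumrN.
  by apply: eq_bigr => i _; rewrite opprB.
have -> : X k = X 0%N by rewrite -[RHS]Xk.
by rewrite [t 0%N]big_ord0 mulrBr.
Qed.

Lemma indep_unbalanced (F : numFieldType) s C :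
  indep F s -> is_cycle C -> balance F s C = -1.
Proof.
move=> ind Cc; have [b1|//] := balance_sign F s C.
have [c [x0 [[e ce] _ cx]]] := cycle_combination F s Cc.
case/eqP: ce; apply: ind => x.
by rewrite cx b1 subrr mulr0.
Qed.

Lemma unbalanced_potential (F : numFieldType) s C (y : mvert H -> F) :
  is_cycle C -> balance F s C = -1 ->
  (forall e, e \in C -> \sum_x y x * inc F s e x = 0) -> exists x, y x = 0.
Proof.
move=> Cc b1 yC; have [c [x0 [_ c0 cx]]] := cycle_combination F s Cc.
exists x0; have : \sum_x y x * \sum_e c e * inc F s e x = 0.
  under eq_bigr do rewrite mulr_sumr.
  rewrite exchange_big big1 //= => e _.
  have [eC|/c0 ->] := boolP (e \in C).
    by under eq_bigr do rewrite mulrCA; rewrite -mulr_sumr yC // mulr0.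
  by rewrite big1 // => x _; rewrite mul0r mulr0.
under eq_bigr do rewrite cx b1.
rewrite (bigD1 x0) //= big1 ?addr0 => [|x /negbTE->]; last by rewrite mul0r mulr0.
rewrite eqxx mul1r opprK => /eqP; rewrite mulf_eq0 -[1 + 1]/(2%:R) pnatr_eq0 orbF.
by move/eqP.
Qed.

Lemma potential_edge (F : numFieldType) s e a b (y : mvert H -> F) :
  mends e = [set a; b] -> \sum_x y x * inc F s e x = 0 ->
  y b = - (-1) ^+ (s e a (+) s e b) * y a.
Proof.
move=> eE; rewrite (sum_inc _ _ eE) signr_addb addrC => /eqP.
rewrite addr_eq0 => /eqP yE.
have sN : (-1) ^+ s e b * (-1) ^+ s e b = 1 :> F by rewrite -expr2 sqrr_sign.
by rewrite -[LHS]mulr1 -[X in _ * X = _]sN mulrA yE !mulNr -mulrA mulrC.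
Qed.

Lemma potential_eq0 (F : numFieldType) s A (y : mvert H -> F) :
  connecting A -> (forall e, e \in A -> \sum_x y x * inc F s e x = 0) ->
  (exists x, y x = 0) -> forall x, y x = 0.
Proof.
move=> conn yA [x0 yx0] x; apply/eqP.
apply: (conn (fun x => y x == 0) _ x0); last by rewrite yx0.
move=> e a b eA eE /eqP ya; apply/eqP.
by rewrite (potential_edge eE (yA e eA)) ya mulr0.
Qed.

(** A vertex covered by the support of a dependence is covered twice, since a
single nonzero entry does not cancel. *)
Lemma dependence_has_cycle (F : numFieldType) s (c : medge H -> F) :
  (exists e, c e != 0) -> (forall x, \sum_e c e * inc F s e x = 0) ->
  exists2 C, is_cycle C & forall e, e \in C -> c e != 0.
Proof.
move=> [e0 ce0] cx.
pose S := [set e | c e != 0].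
case: (@min_degree_two_has_cycle H S).
- by apply/set0Pn; exists e0; rewrite inE.
- move=> e x; rewrite inE => ce xe.
  have [f /andP[fS fx]|none] := pickP [pred f | (f \in S) & (f != e) && (x \in mends f)].
    by exists f.
  have /eqP := cx x; rewrite (bigD1 e) //= big1 ?addr0.
    by rewrite /inc xe mulf_eq0 signr_eq0 orbF (negbTE ce).
  move=> f fe; have := none f; rewrite /= fe inE /inc /=.
  by case: eqP => [->|_]; [rewrite mul0r | case: ifP; rewrite ?mulr0].
move=> C Cc /subsetP CS; exists C => // e /CS.
by rewrite inE.
Qed.

Lemma choice_of_ends : exists hd : medge H -> mvert H, forall e, hd e \in mends e.
Proof.
apply: (@fin_all_exists (medge H) _ (fun e h => h \in mends e)) => e.
by have [a [b ->]] := ends_pair e; exists a; rewrite !inE eqxx.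
Qed.

(** Marking one end [hd e] of each edge is an orientation; adding the mark to a
signing reverses exactly one of the two signs of every edge. *)
Lemma end_orientation (hd : medge H -> mvert H) e a b :
  hd e \in mends e -> mends e = [set a; b] -> (a == hd e) = (b != hd e).
Proof.
move=> + eE; have /negbTE ab := ends_neq eE.
by rewrite eE !inE => /orP[]/eqP->; rewrite eqxx // eq_sym ab.
Qed.

(** The vectors of an orientation have coordinate sum 0.  So one of the
equations defining a dependence is redundant, and as many edges as vertices are
dependent. *)
Lemma many_edges_have_cycle A : (0 < #|mvert H|)%N ->
  (#|mvert H| <= #|A|)%N -> exists2 C, is_cycle C & C \subset A.
Proof.
case/card_gt0P=> x1 _ leA.
have [hd hdE] := choice_of_ends.
pose s e x := x == hd e.
have sum0 e : \sum_x inc rat s e x = 0.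
  have [a [b eE]] := ends_pair e.
  under eq_bigr do rewrite -[inc _ _ _ _]mul1r.
  rewrite (sum_inc s (fun=> 1) eE) /s (end_orientation (hdE e) eE).
  by case: (b == hd e); rewrite /= !mul1r ?subrr ?addNr.
have lt : (#|~: [set x1]| < #|A|)%N.
  by rewrite cardsC1 (leq_trans _ leA) // prednK //; apply/card_gt0P; exists x1.
have [c [[e ce] cA cx]] := kernel_nontrivial (fun x e => inc rat s e x) lt.
suff c0 x : \sum_e c e * inc rat s e x = 0.
  have [|C Cc CE] := dependence_has_cycle _ c0; first by exists e.
  exists C => //; apply/subsetP=> f /CE.
  by apply: contraR => /cA ->.
have cx' z : z != x1 -> \sum_e c e * inc rat s e z = 0.
  by move=> ?; apply: cx; rewrite !inE.
have [->|/cx'//] := eqVneq x x1.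
have : \sum_z \sum_e c e * inc rat s e z = 0.
  rewrite exchange_big big1 //= => f _.
  by rewrite -mulr_sumr sum0 mulr0.
by rewrite (bigD1 x1) //= [X in _ + X]big1 ?addr0.
Qed.

Lemma indep_le_card (F : fieldType) s :
  indep F s -> (#|medge H| <= #|mvert H|)%N.
Proof.
move=> ind; rewrite leqNgt; apply/negP; rewrite -!cardsT => lt.
have [c [[e ce] _ cx]] := kernel_nontrivial (fun x e => inc F s e x) lt.
by case/eqP: ce; apply: ind => x; apply: cx.
Qed.

(** Suppose the edge [e1] takes part in a dependence.  There are at most as many
edges as vertices, since deleting [e0] leaves no cycle.  So some nonzero
potential is orthogonal to all edges except possibly [e1], hence by the
dependence to [e1] too, against the unbalanced cycle. *)
Lemma unicyclic_indep (F : numFieldType) s C e0 :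
  connecting [set: medge H] -> is_cycle C -> balance F s C = -1 ->
  (forall D, is_cycle D -> e0 \in D) -> indep F s.
Proof.
move=> conn Cc bC all_e0 c cx e1; apply/eqP/negPn/negP=> ce1.
have n0 : (0 < #|mvert H|)%N.
  by have [a _] := ends_pair e0; apply/card_gt0P; exists a.
have : (#|~: [set e0]| < #|mvert H|)%N.
  rewrite ltnNge; apply/negP=> /(many_edges_have_cycle n0)[D Dc /subsetP DS].
  by have := DS _ (all_e0 D Dc); rewrite !inE eqxx.
rewrite cardsC1 -(cardsC1 e1) -[#|mvert H|]cardsT => lt.
have [y [[x yx] _ yA]] := kernel_nontrivial (inc F s) lt.
have yall e : \sum_x y x * inc F s e x = 0.
  have [->|ne] := eqVneq e e1; last by apply: yA; rewrite !inE.
  have : \sum_z y z * \sum_e c e * inc F s e z = 0.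
    by apply: big1 => z _; rewrite cx mulr0.
  under eq_bigr do rewrite mulr_sumr.
  rewrite exchange_big /= (bigD1 e1) //= [X in _ + X]big1 ?addr0.
    under eq_bigr do rewrite mulrCA; rewrite -mulr_sumr => /eqP.
    by rewrite mulf_eq0 (negbTE ce1) => /eqP.
  move=> f fe; under eq_bigr do rewrite mulrCA; rewrite -mulr_sumr.
  by rewrite yA ?mulr0 // !inE.
case/eqP: yx; apply: (potential_eq0 (s := s) conn) => //.
exact: unbalanced_potential Cc bC _.
Qed.

(** By symmetry it is enough to exclude an edge [e0] of a cycle [C'] that is
not on another cycle [D'].  It can be deleted without
disconnecting the graph or destroying [D'].  Independence bounds the remaining
edges by one less than the number of vertices, so a nonzero potential survives,
against the unbalanced cycle [D']. *)
Lemma cycle_unique (F : numFieldType) s C D :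
  connecting [set: medge H] -> indep F s -> is_cycle C -> is_cycle D -> D = C.
Proof.
move=> conn ind.
suff sub C' D' : is_cycle C' -> is_cycle D' -> C' \subset D'.
  by move=> Cc Dc; apply/eqP; rewrite eqEsubset !sub.
move=> Cc Dc; apply/subsetP=> e0 e0C; apply: contraT => e0D.
have lt : (#|~: [set e0]| < #|[set: mvert H]|)%N.
  rewrite cardsC1 cardsT; apply: leq_trans (indep_le_card ind).
  by rewrite prednK //; apply/card_gt0P; exists e0.
have [y [[x yx] _ yA]] := kernel_nontrivial (inc F s) lt.
case/eqP: yx; apply: (potential_eq0 (connecting_cycle_edge Cc e0C conn) yA).
apply: (unbalanced_potential Dc (indep_unbalanced ind Dc)) => e eD.
by apply: yA; rewrite !inE; apply: contraNneq e0D => <-.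
Qed.

(** After reversing one sign on each edge, a potential takes opposite values
at the two ends of an edge if the signs of that edge differ, and equal values
otherwise.  So it is constant up to sign on a connected graph, and its signs are the wanted
changes. *)
Lemma gauge s A : (0 < #|mvert H|)%N -> connecting A -> (#|A| < #|mvert H|)%N ->
  exists tau : mvert H -> bool, forall e x y, e \in A -> x \in mends e ->
    y \in mends e -> s e x (+) tau x = s e y (+) tau y.
Proof.
move=> n0 conn; rewrite -cardsT => lt.
have [hd hdE] := choice_of_ends.
pose s' e x := s e x (+) (x == hd e).
have [y [[x0 yx0] _ yA]] := kernel_nontrivial (inc rat s') lt.
have s'E e a b : mends e = [set a; b] -> s' e a (+) s' e b = ~~ (s e a (+) s e b).
  move=> eE; rewrite /s' (end_orientation (hdE e) eE).
  by case: (b == hd e) (s e a) (s e b) => [] [] [].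
have yE e a b : e \in A -> mends e = [set a; b] ->
    y b = (-1) ^+ (s e a (+) s e b) * y a.
  move=> eA eE; rewrite (potential_edge eE (yA e eA)) s'E // signrN opprK //.
pose tau x := y x != y x0.
have ytau x : y x = (-1) ^+ tau x * y x0.
  have : (y x == y x0) || (y x == - y x0).
    apply: (conn (fun x => (y x == y x0) || (y x == - y x0)) _ x0); last by rewrite eqxx.
    move=> e a b eA eE; rewrite (yE e a b) //.
    by case: (s e a (+) s e b); case/orP=> /eqP->; rewrite ?mulN1r ?mul1r ?opprK eqxx ?orbT.
  by rewrite /tau; case: eqP => [->|_ /= /eqP ->]; rewrite ?mul1r // mulN1r.
exists tau => e a b eA ae be.
have [->//|ab] := eqVneq a b.
have eE : mends e = [set a; b].
  apply/esym/eqP; rewrite eqEcard cards2 ab mends_card leqnn andbT.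
  by apply/subsetP=> z; rewrite !inE => /orP[]/eqP->.
have := yE _ _ _ eA eE; rewrite ytau [y a]ytau mulrA -signr_addb.
move/(mulIf yx0); case: (tau a) (tau b) (s e a) (s e b) => [] [] [] [] //= /eqP;
  by rewrite ?expr0 ?expr1 ?eqr_oppLR // eq_sym -subr_eq0 opprK.
Qed.

End Signings.

(** * Standard form of independent signings *)

Section NormalForms.
Variable H : mgraph.
Implicit Types (e f u : medge H) (x y v : mvert H) (C D : {set medge H}).
Implicit Types (s : medge H -> mvert H -> bool).

(** Up to sign changes at vertices and edges, every independent signing of a
connected multigraph has this form. *)
Definition flip_at (b : bool) u v e x := [&& b, e == u & x == v].

Lemma balance_flip_at (R : comPzRingType) b u v C : u \in C -> v \in mends u ->
  balance R (flip_at b u v) C = (-1) ^+ (odd #|C| (+) b).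
Proof.
move=> uC vu; rewrite /balance prodrN signr_addb signr_odd; congr (_ * _).
rewrite (bigD1 u) //= (bigD1 v) //= /flip_at !eqxx /= andbT.
have -> : \prod_(x in mends u | x != v) (-1) ^+ (b && (x == v)) = 1 :> R.
  by apply: big1 => x /andP[_ /negbTE->]; rewrite andbF.
rewrite mulr1 big1 ?mulr1 // => e /andP[_ /negbTE eu].
by apply: big1 => x _; rewrite eu andbF.
Qed.

(** Sign changes at the vertices in [tau], which do not alter Gram matrices, and
at the edges in [eps], which act on them by switching. *)
Definition switched_to s s' (eps : medge H -> bool) (tau : mvert H -> bool) :=
  forall e x, x \in mends e -> s e x = eps e (+) tau x (+) s' e x.

Lemma inc_switched (R : comPzRingType) s s' eps tau : switched_to s s' eps tau ->
  forall e x, inc R s e x = (-1) ^+ eps e * (-1) ^+ tau x * inc R s' e x.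
Proof.
move=> ss' e x; rewrite /inc; case: ifP => [xe|_]; last by rewrite mulr0.
by rewrite ss' // !signr_addb.
Qed.

Lemma indep_switched (F : fieldType) s s' eps tau : switched_to s s' eps tau ->
  indep F s -> indep F s'.
Proof.
move=> ss' ind c cx e; apply/eqP.
suff /eqP : c e * (-1) ^+ eps e = 0 by rewrite mulf_eq0 signr_eq0 orbF.
apply: (ind (fun e => c e * (-1) ^+ eps e)) => x.
transitivity ((-1) ^+ tau x * \sum_e c e * inc F s' e x); last by rewrite cx mulr0.
rewrite mulr_sumr; apply: eq_bigr => f _; rewrite (inc_switched _ ss').
have sN : (-1) ^+ eps f * (-1) ^+ eps f = 1 :> F by rewrite -expr2 sqrr_sign.
by rewrite !mulrA -[c f * _ * _]mulrA sN mulr1 [c f * _]mulrC.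
Qed.

(** Deleting a cycle edge [u] keeps the graph connected and makes room for a
potential, so the signs of all other edges can be made positive.  The sign of
[u] at its end other than [v] is made positive by switching [u]. *)
Lemma normal_form_off_edge s C u v : mconnected H -> is_cycle C ->
  u \in C -> v \in mends u -> (#|medge H| <= #|mvert H|)%N ->
  exists b eps tau, switched_to s (flip_at b u v) eps tau.
Proof.
move=> /mconnectedP[n0 conn] Cc uC vu le.
have lt : (#|~: [set u]| < #|mvert H|)%N.
  rewrite cardsC1; apply: leq_trans le.
  by rewrite prednK //; apply/card_gt0P; exists u.
have [tau tauE] := gauge s n0 (connecting_cycle_edge Cc uC conn) lt.
have [w uE] : exists w, mends u = [set v; w].
  have [a [b uE]] := ends_pair u; move: vu; rewrite uE !inE.
  by case/orP=> /eqP->; [exists b | exists a; rewrite setUC].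
have vw := ends_neq uE.
have [hd0 hd0P] := choice_of_ends H.
(* The sign at [hd e] is the one made positive by [eps]; at [u] it must not be
   the one at [v]. *)
pose hd e := if e == u then w else hd0 e.
have hdu : hd u = w by rewrite /hd eqxx.
have hdP e : hd e \in mends e.
  by rewrite /hd; case: eqP => // ->; rewrite uE !inE eqxx orbT.
pose eps e := s e (hd e) (+) tau (hd e).
exists (s u v (+) tau v (+) eps u), eps, tau => e x xe.
rewrite /flip_at; have [eu|ne] := eqVneq e u; last first.
  rewrite andbF addbF /eps -(tauE e x (hd e)) // ?inE //.
  by rewrite -addbA addbb addbF.
rewrite eu in xe *; move: xe; rewrite uE !inE => /orP[]/eqP->.
  by rewrite eqxx /= andbT; case: (eps u) (tau v) (s u v) => [] [] [].
rewrite eq_sym (negbTE vw) /= andbF addbF /eps hdu.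
by case: (tau w) (s u w) => [] [].
Qed.

(** With fewer edges than vertices a nonzero potential exists, so no cycle can be
unbalanced and there is none.  Otherwise there is a cycle, and the sign [b]
left undetermined on [u] is read off from its balance, which is [-1] by
independence and which for the standard signing is [-1] to the power
[#|C| + b]. *)
Lemma signing_classification (F : numFieldType) s :
  mconnected H -> (0 < #|medge H|)%N -> indep F s ->
  (is_tree H /\ exists eps tau, switched_to s (fun _ _ => false) eps tau)
  \/ exists C, [/\ is_cycle C, forall D, is_cycle D -> D = C
      & forall u v, u \in C -> v \in mends u ->
        exists eps tau, switched_to s (flip_at (~~ odd #|C|) u v) eps tau].
Proof.
move=> Hc m0 ind; have /mconnectedP[n0 conn] := Hc.
have le := indep_le_card ind.
have [lt|ge] := ltnP #|medge H| #|mvert H|; [left | right].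
  rewrite -cardsT in lt; split; last first.
    have [tau tauE] := gauge s n0 conn lt.
    have [hd hdE] := choice_of_ends H.
    exists (fun e => s e (hd e) (+) tau (hd e)), tau => e x xe.
    by rewrite addbF -(tauE e x (hd e)) ?inE // -addbA addbb addbF.
  have acyc C : ~ is_cycle C.
    move=> Cc; rewrite -[#|mvert H|]cardsT in lt.
    have [y [[x yx] _ yA]] := kernel_nontrivial (inc F s) lt.
    case/eqP: yx; apply: (potential_eq0 conn yA).
    apply: unbalanced_potential Cc (indep_unbalanced ind Cc) _ => e _.
    exact: yA.
  split=> // e f ef; apply/eqP; apply: contraT => ne.
  by case: (acyc _ (parallel_cycle ne ef)).
rewrite -[#|medge H|]cardsT in ge.
have [C Cc _] := many_edges_have_cycle n0 ge.
exists C; split=> [//|D Dc|u v uC vu]; first exact: cycle_unique conn ind Cc Dc.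
have [b [eps [tau ss']]] := normal_form_off_edge s Hc Cc uC vu le.
suff <- : b = ~~ odd #|C| by exists eps, tau.
have := indep_unbalanced (indep_switched ss' ind) Cc.
rewrite balance_flip_at //; case: b (odd #|C|) {ss'} => [] [] //= /eqP.
  by rewrite expr0 -subr_eq0 opprK (pnatr_eq0 _ 2).
by rewrite expr0 -subr_eq0 opprK (pnatr_eq0 _ 2).
Qed.

End NormalForms.

(** * Gram matrices and switching *)

Section Gram.
Variable H : mgraph.
Implicit Types (e f : medge H) (x y v : mvert H).
Implicit Types (s : medge H -> mvert H -> bool).

Definition gram s e f : int := \sum_x inc int s e x * inc int s f x.

Lemma gram_sym s e f : gram s e f = gram s f e.
Proof. by apply: eq_bigr => x _; rewrite mulrC. Qed.

(** Distinct edges of a simple graph share at most one vertex, and then this sum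
has a single term. *)
Lemma gram_common s e f :
  gram s e f = \sum_(x in mends e :&: mends f) (-1) ^+ (s e x (+) s f x).
Proof.
rewrite /gram [RHS]big_mkcond; apply: eq_bigr => x _ /=.
rewrite inE signr_addb /inc; case: (x \in mends e); rewrite ?mul0r //=.
by case: (x \in mends f); rewrite ?mulr0.
Qed.

Lemma gram_diag s e : gram s e e = 2.
Proof.
rewrite gram_common setIid; under eq_bigr do rewrite addbb.
by rewrite sumr_const mends_card.
Qed.

Lemma gram_switched s s' eps tau : switched_to s s' eps tau ->
  forall e f, gram s e f = (-1) ^+ (eps e (+) eps f) * gram s' e f.
Proof.
move=> ss' e f; rewrite /gram mulr_sumr; apply: eq_bigr => x _.
rewrite !(inc_switched _ ss') signr_addb.
have sN : (-1) ^+ tau x * (-1) ^+ tau x = 1 :> int by rewrite -expr2 sqrr_sign.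
by rewrite mulrACA [X in X * _]mulrACA sN mulr1.
Qed.

End Gram.

Section Switching.
Variables (V : finType) (G : sgraph V).
Implicit Types x y : V.

Lemma spos_ssign x y : spos G x y = (ssign G x y == 1).
Proof. by rewrite /ssign; case: (spos G x y); case: (sneg G x y). Qed.

Lemma sneg_ssign x y : sneg G x y = (ssign G x y == -1).
Proof.
by rewrite /ssign; have := sdisj G x y; case: (spos G x y); case: (sneg G x y).
Qed.

Lemma ssign_diag x : ssign G x x = 0.
Proof. by rewrite /ssign spos_irr sneg_irr. Qed.

Lemma ssign_switch_at v x y :
  ssign (switch_at G v) x y = (-1) ^+ ((x == v) (+) (y == v)) * ssign G x y.
Proof.
have [<-|ne] := eqVneq x y; first by rewrite addbb /ssign /= /switch_pos /switch_neg
  spos_irr sneg_irr !if_same.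
rewrite /ssign /= /switch_pos /switch_neg.
have := sdisj G x y; case: (eqVneq x v) => [xv|_]; case: (eqVneq y v) => [yv|_] //=.
- by rewrite xv yv eqxx in ne.
- by case: (spos G x y); case: (sneg G x y).
- by case: (spos G x y); case: (sneg G x y).
by rewrite mul1r.
Qed.

End Switching.

Lemma ssign_switch_set (V : finType) (G : sgraph V) (S : {set V}) x y :
  ssign (switch_set G S) x y = (-1) ^+ ((x \in S) (+) (y \in S)) * ssign G x y.
Proof.
rewrite /switch_set -!(mem_enum S); elim: (enum S) (enum_uniq S) => [|v r IH] /=.
  by rewrite mul1r.
case/andP=> vr ur; rewrite ssign_switch_at IH // mulrA -signr_addb !inE.
congr ((-1) ^+ nat_of_bool _ * _).
by case: (eqVneq x v) => [->|_]; case: (eqVneq y v) => [->|_];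
  rewrite ?(negbTE vr) //=; case: (x \in r).
Qed.

(** Signs and isomorphism are all that matters, so the iterated switchings are
replaced by one sign per vertex. *)
Lemma switching_equivalentP (V W : finType) (G : sgraph V) (G' : sgraph W) :
  switching_equivalent G G' <->
  exists (f : V -> W) (eps : V -> bool), bijective f /\
    forall x y, ssign G' (f x) (f y) = (-1) ^+ (eps x (+) eps y) * ssign G x y.
Proof.
split=> [[S [f fb fE]]|[f [eps [fb fE]]]].
  exists f, (fun x => x \in S); split=> // x y.
  by rewrite -ssign_switch_set /ssign; have [-> ->] := fE x y.
exists [set x | eps x]; exists f => // x y.
by rewrite !spos_ssign !sneg_ssign ssign_switch_set fE !inE.
Qed.

Section Realization.
Variable H : mgraph.
Implicit Types (s : medge H -> mvert H -> bool).

(** The diagonal is left out, as the Gram matrix has 2 there and the adjacency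
matrix 0. *)
Definition realizes s (V : finType) (G : sgraph V) (h : V -> medge H) :=
  bijective h /\ forall x y, x != y -> ssign G x y = gram s (h x) (h y).

Lemma realizes_equivalent s s' eps tau (V W : finType) (G : sgraph V)
    (G' : sgraph W) h h' : switched_to s s' eps tau ->
  realizes s G h -> realizes s' G' h' -> switching_equivalent G G'.
Proof.
move=> ss' [hb hE] [[k hK kK] h'E]; apply/switching_equivalentP.
exists (k \o h), (eps \o h); split=> [|x y /=].
  by apply: bij_comp hb; exists h'.
have [->|ne] := eqVneq x y; first by rewrite !ssign_diag mulr0.
rewrite hE // h'E ?kK //; last first.
  by rewrite (can_eq kK) (bij_eq hb).
by rewrite (gram_switched ss') mulrA -signr_addb addbb mul1r.
Qed.

(** Switching [G'] back to [G] is absorbed in the signs of the edges. *)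
Lemma equivalent_realizes (F : fieldType) s' (V W : finType) (G : sgraph V)
    (G' : sgraph W) h' : switching_equivalent G G' -> realizes s' G' h' ->
  indep F s' -> exists s h, realizes s G h /\ indep F s.
Proof.
move=> /switching_equivalentP[f [eps [fb fE]]] [hb' hE'] ind.
have hb : bijective (h' \o f) by apply: bij_comp.
have [k hK kK] := hb.
pose s e x := eps (k e) (+) s' e x.
exists s, (h' \o f); split; last first.
  apply: (@indep_switched H F s' s (eps \o k) (fun=> false) _ ind) => e x _.
  by rewrite addbF /s addbA addbb.
split=> // x y ne.
have ss' : switched_to s s' (eps \o k) (fun=> false) by move=> e z _; rewrite addbF.
rewrite (gram_switched ss') /= -[h' (f x)]/((h' \o f) x) -[h' (f y)]/((h' \o f) y) !hK.
by rewrite /= -hE' ?(bij_eq fb) // fE mulrA -signr_addb addbb mul1r.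
Qed.

Lemma realizes_integral s (V : finType) (G : sgraph V) h :
  realizes s G h -> integrally_represented G.
Proof.
case=> hb hE.
pose phi v : 'cV[int]_#|mvert H| := \col_i inc int s (h v) (enum_val i).
have dotE u v : dot (phi u) (phi v) = gram s (h u) (h v).
  rewrite /gram big_enum_val /dot.
  by apply: eq_bigr => i _; rewrite !mxE.
exists #|mvert H|, phi.
by split=> [u|u v ne]; rewrite dotE ?gram_diag ?hE.
Qed.

End Realization.

(** * Smallest eigenvalue and independence *)

Section Spectrum.

(** The order of [algC] is partial; a common lower bound makes the elements
comparable. *)
Lemma gt_all_min_exists (r : seq algC) (a : algC) :
  (0 < size r)%N -> (forall z, z \in r -> a < z) ->
  exists2 m, m \in r & forall z, z \in r -> m <= z.
Proof.
elim: r => // x r IH _ gt.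
have xa : a < x by apply: gt; rewrite inE eqxx.
have [r0|r1] := posnP (size r).
  exists x; rewrite ?inE ?eqxx // => z; rewrite inE (size0nil r0) orbF => /eqP->.
  exact: lexx.
have [z zr|m mr le] := IH r1; first by apply: gt; rewrite inE zr orbT.
have ma : a < m by apply: gt; rewrite inE mr orbT.
have cmp : x >=< m.
  have : (x - a) >=< (m - a) by apply: real_comparable; rewrite gtr0_real ?subr_gt0.
  by rewrite /Order.comparable !lerD2r.
have [xm|mx|xm] := comparable_ltgtP cmp.
- exists x; rewrite ?inE ?eqxx // => z; rewrite inE => /orP[/eqP->//|/le].
  by apply: le_trans; apply: ltW.
- exists m; rewrite ?inE ?mr ?orbT // => z; rewrite inE => /orP[/eqP->|/le//].
  exact: ltW.
exists m; rewrite ?inE ?mr ?orbT // => z; rewrite inE => /orP[/eqP->|/le//].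
by rewrite xm.
Qed.

Variables (H : mgraph) (s : medge H -> mvert H -> bool).
Variables (V : finType) (G : sgraph V) (h : V -> medge H).
Hypothesis Gs : realizes s G h.

Let B : 'M[algC]_(#|V|, #|mvert H|) :=
  \matrix_(i, j) inc algC s (h (enum_val i)) (enum_val j).

Lemma adj_gram : sadj_mx G + 2%:M = B *m B^T.
Proof.
case: Gs => hb hE; apply/matrixP=> i j; rewrite !mxE.
under eq_bigr do rewrite !mxE.
rewrite -(big_enum_val (fun x => inc algC s (h (enum_val i)) x * inc algC s (h (enum_val j)) x)).
transitivity ((gram s (h (enum_val i)) (h (enum_val j)))%:~R : algC); last first.
  rewrite /gram rmorph_sum; apply: eq_bigr => x _; rewrite rmorphM /=.
  by congr (_ * _); rewrite /inc; case: ifP; rewrite ?rmorph0 // rmorph_sign.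
have [->|ne] := eqVneq i j; first by rewrite ssign_diag gram_diag add0r.
by rewrite mulr0n addr0 hE // (inj_eq enum_val_inj).
Qed.

Lemma indep_row_free : indep algC s <-> forall v : 'rV_#|V|, v *m B = 0 -> v = 0.
Proof.
have [[k hK kK] _] := Gs.
have sumE (c : medge H -> algC) x : \sum_e c e * inc algC s e x =
    \sum_(i < #|V|) c (h (enum_val i)) * inc algC s (h (enum_val i)) x.
  rewrite -(big_enum_val (fun v => c (h v) * inc algC s (h v) x)) /=.
  by rewrite (reindex h) //; exists k => ? _.
split=> [ind v vB|row c cx e].
  apply/rowP=> i; rewrite mxE.
  pose c e := v 0 (enum_rank (k e)).
  have -> : v 0 i = c (h (enum_val i)) by rewrite /c hK enum_valK.
  apply: ind => x; rewrite sumE.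
  have := congr1 (fun N : 'rV_ _ => N 0 (enum_rank x)) vB; rewrite !mxE => vBx.
  by apply: etrans vBx; apply: eq_bigr => j _; rewrite /c hK enum_valK mxE enum_rankK.
pose w : 'rV[algC]_#|V| := \row_i c (h (enum_val i)).
suff /row w0 : w *m B = 0.
  have := congr1 (fun N : 'rV_ _ => N 0 (enum_rank (k e))) w0.
  by rewrite !mxE enum_rankK kK.
apply/rowP=> j; rewrite !mxE; apply: etrans (cx (enum_val j)).
by rewrite sumE; apply: eq_bigr => i _; rewrite !mxE.
Qed.

Lemma eigenvalue_m2 : ~ eigenvalue (sadj_mx G) (-2) -> indep algC s.
Proof.
move=> no; apply/indep_row_free => v vB; apply/eqP/negPn/negP=> v0.
case: no; apply/eigenvalueP; exists v => //.
have : v *m (sadj_mx G + 2%:M) = 0 by rewrite adj_gram mulmxA vB mul0mx.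
by rewrite mulmxDr mul_mx_scalar => /eqP; rewrite addr_eq0 -scaleNr => /eqP.
Qed.

(** For an eigenvector [v] the hermitian norms satisfy
[|v B|^2 = (a + 2) |v|^2], and [v B] is nonzero by independence.  This also
shows that [a] is real. *)
Lemma eigenvalue_gt_m2 (a : algC) :
  indep algC s -> eigenvalue (sadj_mx G) a -> -2 < a.
Proof.
move=> /indep_row_free row /eigenvalueP[v vA v0].
pose nrm n (w : 'rV[algC]_n) := \sum_i w 0 i * (w 0 i)^*.
have nrmE n (w : 'rV[algC]_n) : nrm n w = (w *m (map_mx Num.conj w)^T) 0 0.
  by rewrite mxE; apply: eq_bigr => i _; rewrite !mxE.
have nrm_gt0 n (w : 'rV[algC]_n) : w != 0 -> 0 < nrm n w.
  case/rV0Pn=> i wi; rewrite /nrm (bigD1 i) //= ltr_pwDl ?mul_conjC_gt0 //.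
  by apply: sumr_ge0 => j _; apply: mul_conjC_ge0.
have vB0 : v *m B != 0 by apply: contraNneq v0 => /row ->.
have Breal : map_mx Num.conj B = B.
  apply/matrixP=> i j; rewrite !mxE /inc; case: ifP; rewrite ?rmorph0 //.
  by rewrite rmorph_sign.
have : nrm _ (v *m B) = (a + 2) * nrm _ v.
  rewrite !nrmE map_mxM Breal trmx_mul mulmxA -[v *m B *m _]mulmxA -adj_gram.
  by rewrite mulmxDr vA mul_mx_scalar -scalerDl -scalemxAl mxE.
move=> E; have := nrm_gt0 _ _ vB0; rewrite E pmulr_lgt0 ?nrm_gt0 //.
by rewrite -ltrBlDr sub0r.
Qed.

(** The characteristic polynomial splits, so a smallest eigenvalue exists as soon
as the matrix is not empty. *)
Lemma smallest_gt_m2P :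
  smallest_eigenvalue_gt_m2 G <-> (0 < #|V|)%N /\ indep algC s.
Proof.
split=> [[a [aA amin] agt]|[V0 ind]].
  split.
    case/eigenvalueP: aA => v _; rewrite lt0n; apply: contraNneq => V0.
    by apply/eqP/rowP=> i; have := ltn_ord i; rewrite {2}V0.
  apply: eigenvalue_m2 => /amin /(lt_le_trans agt).
  by rewrite ltxx.
have [r rE] := closed_field_poly_normal (char_poly (sadj_mx G)).
have rP z : (z \in r) = eigenvalue (sadj_mx G) z.
  rewrite eigenvalue_root_char rE (monicP (char_poly_monic _)) scale1r.
  by rewrite root_prod_XsubC.
have [|z|m mr mmin] := @gt_all_min_exists r (-2).
- have := congr1 (fun p : {poly algC} => size p) rE; rewrite size_char_poly.
  by rewrite (monicP (char_poly_monic _)) scale1r size_prod_XsubC => -[<-].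
- by rewrite rP; apply: eigenvalue_gt_m2.
exists m; last by apply: eigenvalue_gt_m2; rewrite -?rP.
by split=> [|b bA]; rewrite -?rP // mmin ?rP.
Qed.

End Spectrum.

(** * The signing of an integral representation *)

Section RepGraph.
Variables (V : finType) (G : sgraph V) (n : nat) (phi : V -> 'cV[int]_n).
Hypothesis phiP : integral_rep G phi.
Let H := rep_graph phiP.

Definition rep_sign (v : medge H) (i : mvert H) : bool := phi v (val i) 0 < 0.

(** A vector of norm 2 has entries at most 1 in absolute value. *)
Lemma rep_inc v i : inc int rep_sign v i = phi v (val i) 0.
Proof.
rewrite /inc /rep_sign /= /rep_ends inE.
case: eqP => [->//|/= ne].
have : phi v (val i) 0 * phi v (val i) 0 <= 2.
  rewrite -(phiP.1 v) /dot (bigD1 (val i)) //= lerDl.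
  by apply: sumr_ge0 => j _; rewrite -expr2 sqr_ge0.
move: (phi v (val i) 0) ne => z ne zz.
have [/=|/=] : z = 1 \/ z = -1 by nia.
  by move->.
by move->.
Qed.

Lemma rep_gram u v : gram rep_sign u v = dot (phi u) (phi v).
Proof.
rewrite /gram; under eq_bigr do rewrite !rep_inc.
rewrite /dot [RHS](bigID (fun i => [exists w, phi w i 0 != 0])) /= [X in _ = _ + X]big1.
  by rewrite addr0 -(big_sub (fun i => [exists w, phi w i 0 != 0])
      (fun i => phi u i 0 * phi v i 0)).
move=> i; rewrite negb_exists => /forallP/(_ u); rewrite negbK => /eqP->.
by rewrite mul0r.
Qed.

Lemma rep_realizes : @realizes H rep_sign V G id.
Proof.
split=> [|u v ne]; first by exists id.
by rewrite rep_gram phiP.2.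
Qed.

(** Adjacent vertices of [G] have vectors with a common coordinate, so a property
of coordinates closed along the edges of [H] passes from one vertex of [G] to
the next. *)
Lemma rep_graph_connected : sconnected G -> mconnected H.
Proof.
move=> [V0 conn]; apply/mconnectedP.
have [u0 _] := card_gt0P V0.
split.
  have [a _] := @ends_pair H u0; apply/card_gt0P; exists a => //.
move=> P Pcl x y Px.
have endP v a b : a \in @mends H v -> b \in @mends H v -> P a -> P b.
  have [c [d vE]] := @ends_pair H v; rewrite vE !inE.
  case/orP=> /eqP-> /orP[]/eqP-> //; apply: (Pcl v); rewrite ?inE ?vE //.
  by rewrite setUC.
have covered i : exists v : medge H, i \in mends v.
  by have /existsP[v vi] := valP i; exists v; rewrite inE.
pose Q (v : V) := [forall a in @mends H v, P a].
have QP v a : a \in @mends H v -> P a -> Q v.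
  by move=> av Pa; apply/forall_inP=> b bv; apply: endP av bv Pa.
have cl : closed (sadj G) Q.
  suff sub u v : sadj G u v -> Q u -> Q v.
    by move=> u v uv; apply/idP/idP; apply: sub; rewrite // /sadj spos_sym sneg_sym.
  move=> uv /forall_inP Qu.
  have ne : u != v.
    by apply: contraTneq uv => ->; rewrite /sadj spos_irr sneg_irr.
  have : ssign G u v != 0.
    by move: uv; rewrite /sadj /ssign; case: (spos G u v) => //=; case: (sneg G u v).
  have [_ rE] := rep_realizes; rewrite rE // gram_common => nz.
  have [a /setIP[au av]] : exists a, a \in @mends H u :&: @mends H v.
    by apply/set0Pn; apply: contra_neqN nz => /eqP ->; rewrite big_set0.
  exact: (QP v a av (Qu a au)).
have [u xu] := covered x; have [v yv] := covered y.
have := closed_connect cl (conn u v); rewrite -!topredE /= (QP u x xu Px).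
by move/esym/forall_inP/(_ y yv).
Qed.

End RepGraph.

(** * The graphs realized by the standard signings *)

Section SimpleMultigraph.
Variable H : mgraph.
Implicit Types (e f u : medge H) (x y v : mvert H) (C D : {set medge H}).

Lemma meet_at_one_vertex e f : mends e != mends f -> mends e :&: mends f != set0 ->
  exists v, mends e :&: mends f = [set v].
Proof.
move=> ne; rewrite -card_gt0 => c0; apply/cards1P; rewrite eqn_leq c0 andbT.
rewrite leqNgt; apply: contra ne => c2.
have ce : mends e :&: mends f = mends e.
  by apply/eqP; rewrite eqEcard subsetIl mends_card.
have cf : mends e :&: mends f = mends f.
  by apply/eqP; rewrite eqEcard subsetIr mends_card.
by rewrite -{1}ce cf.
Qed.

Lemma cycle_adjacent_edges C : is_cycle C ->
  exists u u', [/\ u \in C, u' \in C & ladj u u'].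
Proof.
case/cycle_walk=> k [X [E [k1 EX _ EI ->]]].
exists (E 0%N), (E 1%N); split.
- by apply/imsetP; exists (Ordinal (ltnW k1)).
- by apply/imsetP; exists (Ordinal k1).
apply/andP; split; first by apply/eqP=> /EI E01; have := E01 (ltnW k1) k1.
by apply/set0Pn; exists (X 1%N); rewrite !EX !inE !eqxx orbT.
Qed.

Hypothesis Hsimple : msimple H.

Lemma line_realizes : realizes (fun _ _ => false) (line_sgraph H) id.
Proof.
split=> [|e f ne]; first by exists id.
rewrite /ssign /= gram_common /ladj ne /=.
have ne' : mends e != mends f by rewrite (inj_eq Hsimple).
have [->|/(meet_at_one_vertex ne')[v ->]] := eqVneq (mends e :&: mends f) set0.
  by rewrite big_set0.
by rewrite big_set1.
Qed.

(** An edge that meets both [u] and [u'] away from their common vertex [v] closes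
a triangle with them, so the star at [v] is the only maximal clique that
contains both. *)
Lemma max_clique_of_star u u' v : (forall D, is_cycle D -> #|D| != 3%N) ->
  ladj u u' -> mends u :&: mends u' = [set v] ->
  max_clique_of u u' = [set f | v \in mends f].
Proof.
move=> no_triangle /andP[uu' _] uv; set K := [set f | _].
have [vu vu'] : v \in mends u /\ v \in mends u'.
  by apply/andP; rewrite -in_setI uv inE.
have other e : v \in mends e -> exists z, mends e = [set v; z].
  have [a [b ->]] := ends_pair e; rewrite !inE.
  by case/orP=> /eqP->; [exists b | exists a; rewrite setUC].
have [w uE] := other u vu; have [z u'E] := other u' vu'.
have wz : w != z.
  by apply: contra_neq uu' => wz; apply: Hsimple; rewrite uE u'E wz.
have KK : lclique K.
  apply/forall_inP=> x; rewrite inE => vx; apply/forall_inP=> y; rewrite inE => vy.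
  apply/implyP=> xy; rewrite /ladj xy; apply/set0Pn; exists v.
  by rewrite inE vx.
have sub L : lclique L -> u \in L -> u' \in L -> L \subset K.
  move=> /forall_inP Lc uL u'L; apply/subsetP=> f fL; rewrite inE.
  apply: contraT => vf.
  have fu : f != u by apply: contraNneq vf => ->.
  have fu' : f != u' by apply: contraNneq vf => ->.
  have meets e t : f != e -> e \in L -> mends e = [set v; t] -> t \in mends f.
    move=> fe eL eE; have /forall_inP/(_ e eL) := Lc f fL.
    rewrite fe /ladj eE => /andP[_ /set0Pn[r]]; rewrite !inE => /andP[rf].
    by case/orP=> /eqP E0; rewrite E0 in rf; rewrite ?rf // (negbTE vf) in rf.
  have wf := meets u w fu uL uE; have zf := meets u' z fu' u'L u'E.
  have fE : mends f = [set w; z].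
    apply/esym/eqP; rewrite eqEcard cards2 wz mends_card leqnn andbT.
    by apply/subsetP=> t; rewrite !inE => /orP[]/eqP->.
  have := triangle_cycle uE fE; rewrite setUC in u'E.
  move=> /(_ _ u'E)/no_triangle/eqP[].
  by rewrite setUC cardsU1 cards2 !inE negb_or eq_sym uu' eq_sym fu' eq_sym fu.
have Kmax : maxset (@lclique H) K.
  apply/maxsetP; split=> // L Lc KL; apply/eqP; rewrite eqEsubset KL andbT.
  by apply: sub; rewrite ?(subsetP KL) ?inE.
rewrite /max_clique_of; case: pickP => [L|/(_ K)] /=; last first.
  by rewrite Kmax !inE vu vu'.
case/and3P=> Lmax uL u'L; have /maxsetP[Lc Lm] := Lmax.
by apply/esym/Lm => //; apply: sub.
Qed.

(** The negative sign of [u] at [v] shows in its products with the other edges at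
[v], which form the clique of [u] and [u']. *)
Lemma ldagger_realizes u u' v : (forall D, is_cycle D -> #|D| != 3%N) ->
  ladj u u' -> mends u :&: mends u' = [set v] ->
  realizes (flip_at true u v) (ldagger u u') id.
Proof.
move=> no_triangle uu' uv; split=> [|e f ne]; first by exists id.
have vu : v \in mends u by have := set11 v; rewrite -uv inE => /andP[].
rewrite /ssign /= gram_common /ldagger_pos /ldagger_neg.
rewrite (max_clique_of_star no_triangle uu' uv) !inE /ladj ne /flip_at /=.
have ne' : mends e != mends f by rewrite (inj_eq Hsimple).
have [->|/(meet_at_one_vertex ne')[z zE]] := eqVneq (mends e :&: mends f) set0.
  by rewrite big_set0.
rewrite zE big_set1 /=.
have [eu|_] := eqVneq e u; have [fu|_] := eqVneq f u => //=.
- by rewrite eu fu eqxx in ne.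
- have -> : (v \in mends f) = (z == v).
    by have /setP/(_ v) := zE; rewrite eu !inE vu eq_sym.
  by case: (z == v).
have -> : (v \in mends e) = (z == v).
  by have /setP/(_ v) := zE; rewrite fu !inE vu andbT eq_sym.
by case: (z == v).
Qed.

End SimpleMultigraph.

Section DoubleEdge.
Variables (H : mgraph) (d : medge H) (u : medge (del_edge d)).
Hypothesis ud : mends (val u) = mends d.

(** The edge [d], with signs plus at [v] and minus at [w], is orthogonal to its
parallel [u], and its products with the other edges at [v] and at [w] are 1 and
-1. *)
Lemma attach_realizes v w : mends u = [set v; w] -> msimple (del_edge d) ->
  realizes (flip_at true d w) (attach (other_edges u v) (other_edges u w)) (oapp val d).
Proof.
move=> uE simp; have vw := ends_neq uE.
have dE : mends d = [set v; w] by rewrite -ud -uE.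
split.
  exists (fun e : medge H => insub e : option (medge (del_edge d))).
    case=> [e|] /=; first by rewrite valK.
    by rewrite insubF // eqxx.
  by move=> e; case: insubP => [? _ <-//|]; rewrite negbK => /eqP->.
have nd (e : medge (del_edge d)) : val e == d = false by apply/negbTE/(valP e).
pose G := attach (other_edges u v) (other_edges u w).
have dash (f : medge (del_edge d)) : ssign G None (Some f) = gram (flip_at true d w) d (val f).
  rewrite /gram; under eq_bigr do rewrite mulrC.
  rewrite (sum_inc _ _ dE) /flip_at eqxx eqxx (negbTE vw) /= expr0 expr1 mulr1 mulrN1.
  rewrite /inc nd /= expr0 /ssign /= !inE.
  have fE x : x \in mends (val f) = (x \in mends f) by [].
  rewrite !fE; have [->|fu] := eqVneq f u; first by rewrite uE !inE !eqxx orbT subrr.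
  have : ~~ ((v \in mends f) && (w \in mends f)).
    apply: contra_neqN fu => /andP[vf wf]; apply: simp.
    apply/esym/eqP; rewrite uE eqEcard cards2 vw mends_card leqnn andbT.
    by apply/subsetP=> t; rewrite !inE => /orP[]/eqP->.
  by case: (v \in mends f); case: (w \in mends f).
case=> [e|] [f|] //= ne.
  have [_ lineE] := line_realizes simp; have := lineE e f ne.
  rewrite gram_common gram_common /flip_at !nd /= => <-.
  by rewrite /ssign /=.
by rewrite gram_sym -dash.
Qed.

End DoubleEdge.

Lemma cycle_embedding (H K : mgraph) (f : mvert H -> mvert K)
    (g : medge H -> medge K) (C : {set medge H}) :
  injective f -> {in C &, injective g} ->
  (forall e, e \in C -> mends (g e) = f @: mends e) ->
  is_cycle C -> is_cycle (g @: C).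
Proof.
move=> fI gI gE [k [x [e [k0 xI eI eE CE]]]].
have eC i : e i \in C by rewrite CE imset_f.
exists k, (f \o x), (g \o e); split=> //.
- exact: inj_comp.
- by move=> i j /= /gI E; apply: eI; apply: E.
- by move=> i /=; rewrite gE // eE imsetU1 imset_set1.
by rewrite CE -imset_comp.
Qed.

(** Deleting an edge that is on every cycle leaves no cycle, and [u] keeps the
ends of [d] joined. *)
Lemma double_edge_tree (H : mgraph) (d : medge H) (u : medge (del_edge d)) :
  mconnected H -> mends (val u) = mends d ->
  (forall D : {set medge H}, is_cycle D -> d \in D) ->
  is_tree (del_edge d) /\ miso H (dup_edge u).
Proof.
move=> /mconnectedP[n0 conn] ud all_d.
have acyc (C : {set medge (del_edge d)}) : ~ is_cycle C.
  move=> Cc; have valC := @cycle_embedding (del_edge d) H id val C.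
  have /imsetP[e _ de] : d \in val @: C.
    apply/all_d/valC => // [x y _ _|e _]; first exact: val_inj.
    by rewrite imset_id.
  by have := valP e; rewrite /= -de eqxx.
split; last first.
  exists id, (fun e => insub e); split; first by exists id.
    exists (oapp val d) => [e|[e|]] /=.
    - by case: insubP => [? _ <-//|]; rewrite negbK => /eqP->.
    - by rewrite valK.
    - by rewrite insubF // eqxx.
  move=> e; rewrite imset_id; case: insubP => [e' _ <-//|].
  by rewrite negbK /= => /eqP->.
split=> //.
- apply/mconnectedP; split=> // P Pcl; apply: conn => e a b _ eE.
  have [ed|ed] := eqVneq e d.
    by apply: (Pcl u) => //; rewrite /= ud -ed.
  by apply: (Pcl (Sub e ed)).
- move=> e f ef; apply/eqP; apply: contraT => ne.
  by case: (acyc _ (parallel_cycle ne ef)).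
by apply/card_gt0P; exists u.
Qed.

(** The isomorphism with a tree having a doubled edge need not send [d], rather
than [u], to the added edge, so the edge [e0] that all cycles contain is only
known to be one of the two. *)
Lemma tree_with_double_edge_unicyclic (H : mgraph) (d : medge H)
    (u : medge (del_edge d)) :
  is_tree_with_double_edge H -> mends (val u) = mends d ->
  [/\ mconnected H, msimple (del_edge d)
    & exists2 e0, e0 \in [set d; val u]
      & forall D : {set medge H}, is_cycle D -> e0 \in D].
Proof.
move=> [T [e [[Tconn Tsimp _ Tacyc] [f [g [fb gb gE]]]]]] ud.
have [f' fK f'K] := fb; have [g' gK g'K] := gb.
(* Distinct parallel edges can only be the added edge and the one it doubles. *)
have par a b : mends a = mends b -> a != b ->
    (g a = None \/ g b = None) /\ (g a = Some e \/ g b = Some e).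
  move=> ab; rewrite -(can_eq gK).
  have : odflt e (g a) = odflt e (g b).
    by apply: Tsimp; rewrite -[mends (odflt _ _)]/(mends (g a))
      -[RHS]/(mends (g b)) !gE ab.
  by case: (g a) (g b) => [x|] [y|] //=; [move=> ->; rewrite eqxx | move=> ->; auto
    | move=> ->; auto].
have du : d != val u by have := valP u; rewrite /= eq_sym.
have [dN dS] := par _ _ (esym ud) du.
split.
- have [n0 conn] := (mconnectedP T).1 Tconn.
  apply/mconnectedP; split; first by case/card_gt0P: n0 => x _; apply/card_gt0P; exists (f' x).
  move=> P Pcl x y Px; rewrite -[y]fK; apply: (conn (P \o f') _ (f x)); last by rewrite /= fK.
  move=> t a b _ tE; apply: (Pcl (g' (Some t))); rewrite ?inE //.
  have := gE (g' (Some t)); rewrite g'K /= tE => E.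
  have -> : mends (g' (Some t)) = f' @: (f @: mends (g' (Some t))).
    by rewrite -imset_comp (eq_imset _ fK) imset_id.
  by rewrite -E imsetU1 imset_set1.
- move=> a b ab; apply/val_inj/eqP; apply: contraT => ne.
  have [aN aS] := par _ _ ab ne.
  have da : g (val a) <> g d by move/(can_inj gK)/eqP; rewrite (negbTE (valP a)).
  have db : g (val b) <> g d by move/(can_inj gK)/eqP; rewrite (negbTE (valP b)).
  by exfalso; case: aN => ?; case: aS => ?; case: dN => ?; case: dS => ?; congruence.
exists (g' None).
  by rewrite !inE !(can2_eq g'K gK); case: dN => ->; rewrite eqxx ?orbT.
move=> D Dc; apply: contraT => noD; exfalso.
apply: (Tacyc ((odflt e \o g) @: D)); apply: cycle_embedding Dc.
- exact: can_inj fK.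
- move=> a b aD bD /=.
  have gN c : c \in D -> g c != None.
    by move=> cD; apply: contraNneq noD => <-; rewrite gK.
  have := gN _ aD; have := gN _ bD; have := can_inj gK (x1 := a) (x2 := b).
  by case: (g a) (g b) => [x|] [y|] //= inj _ _ xy; apply: inj; rewrite xy.
by move=> c _; rewrite -gE.
Qed.

(** * Classification *)

Lemma realized_switching_class (V W : finType) (G : sgraph V) (G' : sgraph W)
    (H : mgraph) (s : medge H -> mvert H -> bool) (h : W -> medge H) :
  switching_equivalent G G' -> realizes s G' h -> indep algC s ->
  (0 < #|medge H|)%N -> integrally_represented G /\ smallest_eigenvalue_gt_m2 G.
Proof.
move=> GG' G's ind m0.
have [s' [h' [Gs' ind']]] := equivalent_realizes GG' G's ind.
split; first exact: realizes_integral Gs'.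
apply/(smallest_gt_m2P Gs'); split=> //.
by case: Gs' => hb _; rewrite (bij_eq_card hb).
Qed.

Lemma even_unicyclic_no_triangle (H : mgraph) (C : {set medge H}) :
  (forall D, is_cycle D -> D = C) -> ~~ odd #|C| ->
  forall D : {set medge H}, is_cycle D -> #|D| != 3%N.
Proof. by move=> uniqC evenC D /uniqC ->; apply: contraNneq evenC => ->. Qed.

Theorem theorem6 :
  (forall (V : finType) (G : sgraph V) (n : nat) (phi : V -> 'cV[int]_n)
     (phiP : integral_rep G phi),
     sconnected G -> smallest_eigenvalue_gt_m2 G ->
     let H := rep_graph phiP in
     case_i G H \/ case_ii G H \/ case_iii G H)
  /\
  (forall (V : finType) (G : sgraph V),
     (exists H : mgraph, case_i G H \/ case_ii G H \/ case_iii G H) ->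
     integrally_represented G /\ smallest_eigenvalue_gt_m2 G).
Proof.
split=> [V G n phi phiP Gconn Ggt H|V G [H [|[]]]].
- have Gs := rep_realizes phiP.
  have [m0 ind] := (smallest_gt_m2P Gs).1 Ggt.
  have Hc : mconnected H := rep_graph_connected phiP Gconn.
  have [[tree [eps [tau ss']]]|[C [Cc Cuniq nf]]] := signing_classification Hc m0 ind.
    left; split; first by left.
    by apply: realizes_equivalent ss' Gs (line_realizes _); have [] := tree.
  have [simp|] := boolP [forall e : medge H, forall f : medge H,
      (mends e == mends f) ==> (e == f)].
    have {}simp : msimple H.
      move=> e f /eqP ef; apply/eqP.
      by have /forallP/(_ e)/forallP/(_ f)/implyP := simp; apply.
    have [u [u' [uC u'C uu']]] := cycle_adjacent_edges Cc.
    have uni : unicyclic_with C by split.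
    have [odC|evC] := boolP (odd #|C|).
      have [v [w uE]] := ends_pair u.
      have vu : v \in mends u by rewrite uE !inE eqxx.
      have [eps [tau]] := nf u v uC vu; rewrite odC => ss'.
      left; split; first by right; exists C.
      have {}ss' : switched_to (@rep_sign V G n phi phiP) (fun _ _ => false) eps tau := ss'.
      exact: realizes_equivalent ss' Gs (line_realizes simp).
    have no_triangle := even_unicyclic_no_triangle Cuniq evC.
    have /andP[ne meet] := uu'.
    have [|v uv] := meet_at_one_vertex _ meet; first by rewrite (inj_eq simp).
    have vu : v \in mends u by have := set11 v; rewrite -uv inE => /andP[].
    have [eps [tau]] := nf u v uC vu; rewrite evC => ss'.
    right; left; exists C; split=> //; exists u, u'; split=> //.
    exact: realizes_equivalent ss' Gs (ldagger_realizes simp no_triangle uu' uv).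
  rewrite negb_forall => /existsP[u]; rewrite negb_forall => /existsP[d].
  rewrite negb_imply => /andP[/eqP ud ne].
  have CE := Cuniq _ (parallel_cycle ne ud).
  pose u1 : medge (del_edge d) := Sub u ne.
  have [v [w uE]] := @ends_pair (del_edge d) u1.
  have dC : d \in C by rewrite -CE !inE eqxx orbT.
  have wd : w \in mends d by rewrite -ud -[mends u]/(mends u1) uE !inE eqxx orbT.
  have [eps [tau]] := nf d w dC wd; rewrite -CE cards2 ne /= => ss'.
  have all_d D : is_cycle D -> d \in D by move/Cuniq->.
  have [tree iso] := @double_edge_tree H d u1 Hc ud all_d.
  right; right; split; first by exists (del_edge d), u1.
  exists d, u1, v, w; split=> //.
  have [_ simp _ _] := tree.
  exact: realizes_equivalent ss' Gs (@attach_realizes H d u1 ud v w uE simp).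
- move=> [shape GG'].
  have simp : msimple H by case: shape => [[]//|[C [[]//]]].
  have Gs := line_realizes simp.
  case: shape => [[_ _ m0 acyc]|[C [[Hc _ Cc Cuniq] odC]]].
    apply: realized_switching_class GG' Gs _ m0 => c cx e; apply/eqP/negPn/negP=> ce.
    have [|C Cc _] := dependence_has_cycle _ cx; first by exists e.
    exact: acyc Cc.
  have [u [_ [uC _ _]]] := cycle_adjacent_edges Cc.
  have [v [w uE]] := ends_pair u.
  have vu : v \in mends u by rewrite uE !inE eqxx.
  apply: realized_switching_class GG' Gs _ _; last by apply/card_gt0P; exists u.
  apply: (unicyclic_indep (C := C) (e0 := u)) => //.
  + by have [] := (mconnectedP H).1 Hc.
  + by rewrite (balance_flip_at algC false uC vu) odC.
  by move=> D /Cuniq->.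
- move=> [C [[Hc simp Cc Cuniq] evC [u [u' [uC u'C uu' GG']]]]].
  have no_triangle := even_unicyclic_no_triangle Cuniq evC.
  have /andP[ne meet] := uu'.
  have [|v uv] := meet_at_one_vertex _ meet; first by rewrite (inj_eq simp).
  have vu : v \in mends u by have := set11 v; rewrite -uv inE => /andP[].
  apply: realized_switching_class GG' (ldagger_realizes simp no_triangle uu' uv) _ _;
    last by apply/card_gt0P; exists u.
  apply: (unicyclic_indep (C := C) (e0 := u)) => //.
  + by have [] := (mconnectedP H).1 Hc.
  + by rewrite balance_flip_at // (negbTE evC).
  by move=> D /Cuniq->.
move=> [dbl [d [u [v [w [ud uE GG']]]]]].
have [Hc simp [e0 e0C all_e0]] := tree_with_double_edge_unicyclic dbl ud.
apply: realized_switching_class GG' (attach_realizes ud uE simp) _ _;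
  last by apply/card_gt0P; exists d.
have du : d != val u by have := valP u; rewrite /= eq_sym.
apply: (unicyclic_indep (C := [set d; val u]) (e0 := e0)) => //.
- by have [] := (mconnectedP H).1 Hc.
- exact: parallel_cycle du (esym ud).
rewrite balance_flip_at ?cards2 ?du // ?inE ?eqxx //.
by rewrite -ud -[mends (val u)]/(mends u) uE !inE eqxx orbT.
Qed.
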